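(* Let $S$ be a linear operator mapping characteristic functions of Borel subsets of $\mathbb{R}^n$ to non-negative Borel measurable functions, with adjoint $S^*$ (so that $\langle S\chi_E,\chi_F\rangle = \langle \chi_E, S^*\chi_F\rangle$), and for Borel sets $E,F$ write $\mathcal{S}(E,F) := \langle S\chi_E,\chi_F\rangle$. Let $r,s$ be real numbers with $1<r<s<\infty$, and $u,v$ real numbers with $u<s$, $u<v$ and $r<v$. Suppose the following two hypotheses hold. Hypothesis 1: If $E_1,E_2,F$ are Borel sets with positive finite measures, if for $j=1,2$ one has $S\chi_{E_j}\geq \alpha_j$ on $F$ and $\mathcal{S}(E_j,F)/|E_j| \geq \beta_j$, and if $\alpha_2\geq\alpha_1$ and $\beta_1\geq\beta_2$, then there exist real numbers $u_1,u_2,u_3,u_4$, taken from a finite list depending only on $S$, satisfying $u_1+u_2 = \frac{r'}{r'-s'}$, $u_3+u_4=\frac{r}{s-r}$ and $\frac{u_2}{r}-\frac{u_4}{r'}-1>0$, such that $\alpha_1^{u_1}\alpha_2^{u_2}\beta_1^{u_3}\beta_2^{u_4}\leq C|E_2|$, where $C$ depends only on $S$. Hypothesis 2: If $E,F_1,F_2$ are Borel sets with positive finite measures, if for $j=1,2$ one has $S^*\chi_{F_j}\geq\beta_j$ on $E$ and $\mathcal{S}(E,F_j)/|F_j|\geq\alpha_j$, and if $\alpha_1\geq\alpha_2$ and $\beta_2\geq\beta_1$, then there exist real numbers $v_1,v_2,v_3,v_4$, taken from a finite list depending only on $S$, satisfying $v_1+v_2=\frac{s'}{r'-s'}$, $v_3+v_4=\frac{s}{s-r}$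 and $\frac{v_4}{s'}-\frac{v_2}{s}-1>0$, such that $\alpha_1^{v_1}\alpha_2^{v_2}\beta_1^{v_3}\beta_2^{v_4}\leq C|F_2|$, where $C$ depends only on $S$. Then $S$ extends to a bounded linear operator from $L^{r,u}(\mathbb{R}^n)$ to $L^{s,v}(\mathbb{R}^n)$.
   Context: $|\cdot|$ denotes Lebesgue measure, $L^{p,u}$ denotes the Lorentz space, and $p'$ denotes the dual exponent $p/(p-1)$. *)

(* Defs.v *)
From HB Require Import structures.
From mathcomp Require Import all_boot all_order all_algebra.
From mathcomp Require Import all_classical all_reals all_analysis measurable_realfun.
Set Implicit Arguments. Unset Strict Implicit. Unset Printing Implicit Defensive.
Import Order.TTheory GRing.Theory Num.Theory.
Import numFieldNormedType.Exports.
Local Open Scope classical_set_scope.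
Local Open Scope ring_scope.

(* R^n is modelled as n.-tuple R with its product (= Borel) sigma-algebra,
   as provided by mathcomp-analysis (measurable_structure.v). *)
Notation Rn R n := (n.-tuple R).

Definition box {R : realType} {n : nat} (a b : n.-tuple R) : set (n.-tuple R) :=
  [set x | forall i : 'I_n, tnth a i <= tnth x i <= tnth b i].

(* mu is Lebesgue measure on the Borel sets of R^n: it gives every closed box
   its volume.  (On Borel sets this characterizes Lebesgue measure.) *)
Definition is_lebesgue_Rn {R : realType} {n : nat}
  (mu : {measure set (n.-tuple R) -> \bar R}) : Prop :=
  forall a b : n.-tuple R, (forall i, tnth a i <= tnth b i) ->
    mu (box a b) = (\prod_(i < n) (tnth b i - tnth a i)%:E)%E.

Section Lorentz.
Context {R : realType} {n : nat} (mu : {measure set (n.-tuple R) -> \bar R}).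
Local Open Scope ereal_scope.

Definition distrib (f : n.-tuple R -> R) (t : R) : \bar R :=
  mu [set x | t < `|f x|]%R.

Definition rearr (f : n.-tuple R -> R) (t : R) : \bar R :=
  ereal_inf [set s%:E | s in [set s : R | (0 <= s)%R /\ distrib f s <= t%:E]].

Definition lorentz_norm (p q : R) (f : n.-tuple R -> R) : \bar R :=
  (\int[@lebesgue_measure R]_(t in [set t : R | (0 < t)%R])
      (((t `^ p^-1)%:E * rearr f t) `^ q * (t^-1)%:E)) `^ q^-1.

Definition in_lorentz (p q : R) (f : n.-tuple R -> R) : Prop :=
  measurable_fun [set: n.-tuple R] f /\ lorentz_norm p q f < +oo.

Definition pairS (S : set (n.-tuple R) -> n.-tuple R -> \bar R)
  (E F : set (n.-tuple R)) : \bar R :=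
  \int[mu]_(x in F) S E x.

End Lorentz.

Definition dual_exp {R : realType} (p : R) : R := p / (p - 1).

(* Main.v *)
(* The pairing <S 1_E, 1_F> obeys the restricted bound |E|^(1/r) |F|^(1/s'), from
   Hypothesis 1 with E_1 = E_2 on a superlevel set of S 1_E.  Fix F and sets E_j
   of measure at most 2^j whose pairings with F are at least eps times this bound.
   Hypothesis 1, applied to the intersection of the sets where S 1_{E_i} and
   S 1_{E_j} are large, shows that this intersection is smaller than |F| by a
   factor eps^(-B) 2^(-theta |i - j|).  Hence for indices j separated by a gap of
   order log(1/eps) the sets E_j interact with essentially disjoint parts of F;
   Hypothesis 2 gives the same with the roles of E and F exchanged.  For
   1/s < p < 1/r the two disjointness relations, Young's inequality and a small
   power of eps to spare bound the sum of a_j b_k <S 1_{E_j}, 1_{F_k}> over all j, k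
   by an l^(1/p) and an l^(1/(1-p)) norm, after summation over dyadic eps.
   Decomposing f along its decreasing rearrangement and testing S f on subsets
   of its superlevel sets turns this into L^{r,u} -> L^{s,v} with u <= 1/p <= v. *)
Require Import Defs.
From HB Require Import structures.
From mathcomp Require Import all_boot all_order all_algebra.
From mathcomp Require Import all_classical all_reals all_analysis measurable_realfun.
From mathcomp Require Import lra ring.
Set Implicit Arguments. Unset Strict Implicit. Unset Printing Implicit Defensive.
Import Order.TTheory GRing.Theory Num.Theory.
Import numFieldNormedType.Exports.
Local Open Scope classical_set_scope.
Local Open Scope ring_scope.

(** * Restricted bounds *)

Section real_powers.
Context {R : realType}.
Implicit Types a b x : R.

(** Put [al] = 1/r and [be] = 1/s'. The excess in [al + be > 1] drives the proof. For pairings of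
    relative size about eps the two disjointness relations bound this size by phi^al * theta^be,
    where phi and theta are relative measures of disjoint pieces. Young's inequality wants the
    exponents p and 1 - p. For 1/s < p < 1/r both are smaller than [al] and [be], so a geometric
    mean with the trivial bound eps reaches them and still leaves a factor eps^t. That factor pays
    for the roughly log(1/eps)^2 pairs of residue classes needed to separate the indices. The
    conditions on u and v, with r < s, say that max(r, u) < min(s, v), which is the room for 1/p.
    The extension is not built by density. A nonnegative f is expanded as a series of 1_A / (i + 1)
    over greedily chosen sets A, and S is applied to each term. These sets depend on f in a
    nonlinear way; linearity comes back by testing, since the integral of T f over F is the integral
    of f times [S' F], and these integrals determine T f almost everywhere. *)

Lemma powR_expR x a : expR x `^ a = expR (a * x).
Proof. by rewrite /powR gt_eqF ?expR_gt0// expRK. Qed.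

Lemma gt0_expR a : 0 < a -> exists x, a = expR x.
Proof. by move=> a0; exists (ln a); rewrite lnK. Qed.

(** For a pairing not yet known to be finite: the hypothesis is applied to each real lower bound [q]
    of it, and finiteness comes out with the bound. *)
Lemma le_EFin_of_le_below (p : \bar R) (K : R) : 0 <= K ->
  (forall q : R, 0 < q -> (q%:E <= p)%E -> q <= K) -> (p <= K%:E)%E.
Proof.
move=> K0; case: p => [p| |] h; rewrite ?leNye//.
- rewrite lee_fin; have [p0|p0] := ltP 0 p; first exact: h.
  exact: le_trans p0 K0.
- by have := h (K + 1) (ltr_wpDl K0 ltr01) (leey _); rewrite leNgt ltrDl ltr01.
Qed.

End real_powers.

Section restricted_estimates.
Context d {X : measurableType d} {R : realType} (mu : {measure set X -> \bar R}).
Implicit Types (S : set X -> X -> \bar R) (E F : set X).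

Definition nonneg_measurable S := forall E, measurable E ->
  measurable_fun [set: X] (S E) /\ forall x, (0 <= S E x)%E.

Definition adjoint S S' := forall E F, measurable E -> measurable F ->
  (\int[mu]_(x in F) S E x = \int[mu]_(x in E) S' F x)%E.

(* With [al = 1/r] and [be = 1/s'], Hypothesis 1 is this statement for [S] and
   Hypothesis 2 is this statement for [S*] with [al] and [be] exchanged. *)
Definition two_set_estimate S (al be : R) :=
  exists (C : R) (L : seq (R * R * R * R)),
  (forall w, w \in L -> let: (w1, w2, w3, w4) := w in
     [/\ w1 + w2 = be / (al + be - 1), w3 + w4 = (1 - be) / (al + be - 1) &
         0 < w2 * al - w4 * (1 - al) - 1]) /\
  forall E1 E2 F (a1 a2 b1 b2 : R),
    measurable E1 -> measurable E2 -> measurable F ->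
    (0 < mu E1 < +oo)%E -> (0 < mu E2 < +oo)%E -> (0 < mu F < +oo)%E ->
    0 < a1 -> 0 < a2 -> 0 < b1 -> 0 < b2 ->
    (forall x, F x -> (a1%:E <= S E1 x)%E) ->
    (forall x, F x -> (a2%:E <= S E2 x)%E) ->
    (b1%:E <= (\int[mu]_(x in F) S E1 x) * ((fine (mu E1))^-1)%:E)%E ->
    (b2%:E <= (\int[mu]_(x in F) S E2 x) * ((fine (mu E2))^-1)%:E)%E ->
    a1 <= a2 -> b2 <= b1 ->
    exists2 w, w \in L & let: (w1, w2, w3, w4) := w in
      a1 `^ w1 * a2 `^ w2 * b1 `^ w3 * b2 `^ w4 <= C * fine (mu E2).

Definition restricted_bound S (al be C : R) := forall E F (x y : R),
  measurable E -> measurable F -> 0 < x -> 0 < y ->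
  (mu E <= x%:E)%E -> (mu F <= y%:E)%E ->
  (\int[mu]_(t in F) S E t <= (C * (x `^ al * y `^ be))%:E)%E.

(** The level [x ^ al * y ^ (be - 1)] is the constant value on a set of measure [y] at which a
    pairing reaches [x ^ al * y ^ be]; [e] is the height relative to it. *)
Definition overlap_bound S (al be C B th : R) :=
  forall E1 E2 F (e x1 x2 y : R),
  measurable E1 -> measurable E2 -> measurable F ->
  0 < e -> 0 < x1 -> x1 <= x2 -> 0 < y ->
  (mu E1 <= x1%:E)%E -> (mu E2 <= x2%:E)%E -> (mu F <= y%:E)%E ->
  (forall t, F t -> ((e * (x1 `^ al * y `^ (be - 1)))%:E <= S E1 t)%E) ->
  (forall t, F t -> ((e * (x2 `^ al * y `^ (be - 1)))%:E <= S E2 t)%E) ->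
  (mu F <= (C * e `^ (- B) * (x1 / x2) `^ th * y)%:E)%E.

Section consequences.
Variables (S S' : set X -> X -> \bar R) (al be : R).
Hypotheses (S0 : nonneg_measurable S) (S'0 : nonneg_measurable S').
Hypothesis SS' : adjoint S S'.
Hypotheses (be0 : 0 < be) (be1 : be < 1) (abgt1 : 1 < al + be).
Hypothesis est : two_set_estimate S al be.

(** Passing to the adjoint turns the null set into the domain of integration. *)
Lemma pairing_null E F : measurable E -> measurable F -> mu E = 0%E ->
  (\int[mu]_(x in F) S E x = 0)%E.
Proof.
move=> mE mF E0; rewrite SS'// -[RHS](integral_abs_eq0 mE _ E0 (f := S' F)).
  by apply: eq_integral => x _; rewrite gee0_abs//; apply: (S'0 mF).2.
exact: measurable_funTS (S'0 mF).1.
Qed.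

Lemma pairing_ge E F a : measurable E -> measurable F -> 0 <= a ->
  (forall x, F x -> (a%:E <= S E x)%E) ->
  (a%:E * mu F <= \int[mu]_(x in F) S E x)%E.
Proof.
move=> mE mF a0 h; rewrite -integral_cst//; apply: ge0_le_integral => //.
exact: measurable_funTS (S0 mE).1.
Qed.

Lemma pairing_le E F a : measurable E -> measurable F -> 0 <= a ->
  (forall x, F x -> (S E x <= a%:E)%E) ->
  (\int[mu]_(x in F) S E x <= a%:E * mu F)%E.
Proof.
move=> mE mF a0 h; rewrite -integral_cst//; apply: ge0_le_integral => //.
- by move=> x _; apply: (S0 mE).2.
- exact: measurable_funTS (S0 mE).1.
Qed.

Lemma pairing_ge0 E F : measurable E -> (0 <= \int[mu]_(x in F) S E x)%E.
Proof. by move=> mE; apply: integral_ge0 => x _; apply: (S0 mE).2. Qed.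

Lemma pairing_gt0 E F : measurable E -> measurable F ->
  (0 < \int[mu]_(x in F) S E x)%E -> (0 < mu E)%E.
Proof.
move=> mE mF p0; rewrite lt0e measure_ge0 andbT; apply: contraTneq p0 => E0.
by rewrite pairing_null// ltxx.
Qed.

(* Hypothesis 1 with [E1 = E2]. *)
Lemma level_bound : exists C : R, forall E F (a x : R),
  measurable E -> measurable F -> 0 < a -> 0 < x ->
  (mu E <= x%:E)%E -> (mu F < +oo)%E -> (forall t, F t -> (a%:E <= S E t)%E) ->
  (\int[mu]_(t in F) S E t
     <= (expR C * (a `^ (- (be / (1 - be))) * x `^ (al / (1 - be))))%:E)%E.
Proof.
have g0 : 0 < al + be - 1 by rewrite subr_gt0.
have b1 : 0 < 1 - be by rewrite subr_gt0.
have [C [L [hL h]]] := est.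
(* A positive constant has a logarithm. With every quantity written as an exponential, the estimates
   become linear inequalities between exponents. *)
set c := Num.max C 1; have c1 : 0 < c by rewrite lt_max ltr01 orbT.
have [lc cE] := gt0_expR c1.
exists (lc * ((al + be - 1) / (1 - be))) => E F a x mE mF a0 x0 Ex Foo aS.
have [z zE] := gt0_expR x0; have [a' aE] := gt0_expR a0; subst x.
apply: le_EFin_of_le_below => [|q q0 qp]; first by rewrite !mulr_ge0 ?powR_ge0 ?expR_ge0.
have E0 : (0 < mu E)%E by apply: (pairing_gt0 mE mF); apply: lt_le_trans qp.
have Efin : mu E \is a fin_num by rewrite ge0_fin_numE// (le_lt_trans Ex) ?ltry.
have F0 : (0 < mu F)%E.
  rewrite lt0e measure_ge0 andbT; apply/eqP => F0.
  move: qp; rewrite leNgt => /negP; apply.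
  have -> : (\int[mu]_(x in F) S E x = 0)%E; last by rewrite lte_fin.
  rewrite -[RHS](integral_abs_eq0 mF _ F0 (f := S E)).
    by apply: eq_integral => t _; rewrite gee0_abs//; apply: (S0 mE).2.
  exact: measurable_funTS (S0 mE).1.
set m := fine (mu E).
have m0 : 0 < m by rewrite fine_gt0// E0 /= -ge0_fin_numE.
have mEf : mu E = m%:E by rewrite fineK.
have mz : m <= expR z by rewrite -lee_fin -mEf.
have [k mk] := gt0_expR m0.
have [p qE] := gt0_expR q0.
have qm0 : 0 < q / m by rewrite divr_gt0.
have Eb : (0 < mu E < +oo)%E by rewrite E0 mEf ltry.
have Fb : (0 < mu F < +oo)%E by rewrite F0.
have qb : ((q / m)%:E <= (\int[mu]_(x in F) S E x) * ((fine (mu E))^-1)%:E)%E.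
  by rewrite EFinM lee_wpmul2r// lee_fin invr_ge0 ltW.
have [[[[w1 w2] w3] w4] /hL[w12 w34 _]] :=
  h E E F a a (q / m) (q / m) mE mE mF Eb Eb Fb a0 a0 qm0 qm0 aS aS qb qb (lexx _) (lexx _).
rewrite -/m => hw.
have {}hw : a `^ w1 * a `^ w2 * (q / m) `^ w3 * (q / m) `^ w4 <= c * m.
  by apply: le_trans hw _; rewrite ler_wpM2r ?(ltW m0)// le_max lexx.
move: hw mz; rewrite aE qE cE mk -expRN -!expRD !powR_expR -!expRD !ler_expR => hw mz.
(* With equal sets only the sums [w1 + w2] and [w3 + w4] survive, and these are prescribed, so it
   does not matter which tuple of the list was returned. *)
have {}hw : (w1 + w2) * a' + (w3 + w4) * (p - k) <= lc + k by rewrite mulrDl (mulrDl w3) addrA.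
move: hw; rewrite w12 w34 => hw.
have {}hw : be * a' + (1 - be) * (p - k) <= (lc + k) * (al + be - 1).
  rewrite -ler_pdivrMr//; apply: le_trans hw.
  by rewrite le_eqVlt; apply/orP; left; apply/eqP; field; rewrite gt_eqF.
have {}hw : (1 - be) * p <= lc * (al + be - 1) - be * a' + al * k by lra.
have {}hw : (1 - be) * p <= lc * (al + be - 1) - be * a' + al * z.
  apply: le_trans hw _; rewrite lerD2l ler_wpM2l//; lra.
rewrite -(ler_pM2l b1); apply: le_trans hw _.
by rewrite le_eqVlt; apply/orP; left; apply/eqP; field; rewrite gt_eqF.
Qed.

Lemma restricted_bound_of_estimate : exists2 C, 0 < C & restricted_bound S al be C.
Proof.
have [C hC] := level_bound.
exists (expR C + 1); first by rewrite ltr_wpDl// expR_ge0.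
move=> E F x y mE mF x0 y0 Ex Fy.
have [z zE] := gt0_expR x0; have [k kE] := gt0_expR y0.
(* The balancing level x^al * y^(be - 1): [level_bound] above it and the trivial bound [lam * y]
   below it both give a multiple of x^al * y^be. *)
set lam := expR (al * z - (1 - be) * k).
have lam0 : 0 < lam by exact: expR_gt0.
pose G := F `&` [set t | (lam%:E <= S E t)%E].
have mG : measurable G.
  rewrite /G; have := emeasurable_fun_c_infty mF (measurable_funTS (D := F) (S0 mE).1).
  by apply.
have mFG : measurable (F `\` G) by exact: measurableD.
rewrite -(setUIDK F G) ge0_integral_setU//; last 4 first.
- exact: measurableI.
- exact: measurable_funTS (S0 mE).1.
- by move=> t _; apply: (S0 mE).2.
- by apply/disj_setPS => t -[[_ ?] [_]].
have -> : F `&` G = G by rewrite setIA setIid.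
rewrite mulrDl mul1r EFinD; apply: leeD.
- have muG : (mu G < +oo)%E.
    apply: le_lt_trans (ltry y); apply: le_trans Fy.
    by apply: le_measure; rewrite ?inE//; apply: subIsetl.
  apply: le_trans (hC E G lam x mE mG lam0 x0 Ex muG _) _; first by move=> t [].
  rewrite lee_fin /lam zE kE !powR_expR -!expRD ler_expR le_eqVlt; apply/orP; left.
  by apply/eqP; field; rewrite gt_eqF// subr_gt0.
- apply: (@le_trans _ _ (lam%:E * mu (F `\` G))%E).
    apply: pairing_le => // [|t [Ft nG]]; first exact: ltW.
    by apply: ltW; rewrite ltNge; apply/negP => tl; apply: nG.
  apply: (@le_trans _ _ (lam%:E * y%:E)%E).
    rewrite lee_wpmul2l ?lee_fin ?(ltW lam0)//; apply: le_trans Fy.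
    by apply: le_measure; rewrite ?inE//; apply: subDsetl.
  rewrite -EFinM lee_fin /lam zE kE !powR_expR -!expRD ler_expR le_eqVlt; apply/orP; left.
  by apply/eqP; ring.
Qed.

End consequences.
End restricted_estimates.

(** Here the finiteness of the list of exponents enters: a strict inequality for each tuple becomes
    one uniform gain. *)
Lemma seq_pos_lower_bound {R : realDomainType} {T : eqType} (f : T -> R) (L : seq T) :
  (forall w, w \in L -> 0 < f w) -> exists2 c, 0 < c & forall w, w \in L -> c <= f w.
Proof.
elim: L => [|w L IH] h; first by exists 1.
have [|c c0 hc] := IH; first by move=> t tL; apply: h; rewrite inE tL orbT.
exists (Num.min c (f w)); first by rewrite lt_min c0 h// mem_head.
move=> t; rewrite inE => /orP[/eqP ->|/hc ct]; first by rewrite ge_min lexx orbT.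
by rewrite ge_min ct.
Qed.

Lemma geometric_tail_le {R : realFieldType} (q : R) (A j : nat) : 0 < q < 1 ->
  \sum_(i < j | (A <= j - i)%N) q ^+ (j - i) <= q ^+ A / (1 - q).
Proof.
move=> /andP[q0 q1]; have q1' : 0 < 1 - q by rewrite subr_gt0.
rewrite ler_pdivlMr// mulrC.
(* Telescoped form, suited to induction on [j]. The maximum covers [j < A], where the sum is empty
   and the right-hand side is 0. *)
suff : (1 - q) * (\sum_(i < j | (A <= j - i)%N) q ^+ (j - i))
    <= q ^+ A - q ^+ (maxn A j.+1).
  by move=> /le_trans; apply; rewrite gerBl exprn_ge0// ltW.
elim: j => [|j IH].
  by rewrite big_ord0 mulr0 subr_ge0; apply: ler_wiXn2l; rewrite ?leq_maxl// ltW.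
rewrite big_mkcond big_ord_recl/= subn0.
under eq_bigr do rewrite /bump/= add1n subSS.
rewrite -big_mkcond/=.
case: leqP => [Aj|jA].
  rewrite (maxn_idPr _) ?(leq_trans Aj)//.
  rewrite (maxn_idPr Aj) in IH.
  rewrite mulrDr; apply: le_trans (lerD (lexx _) IH) _.
  by rewrite le_eqVlt; apply/orP; left; apply/eqP; rewrite [q ^+ j.+2]exprS; ring.
by rewrite add0r (maxn_idPl jA); rewrite (maxn_idPl (ltnW jA)) in IH.
Qed.

Lemma measure_bigsetU_le {d} {X : measurableType d} {R : realType}
    (mu : {measure set X -> \bar R}) (I : Type) (s : seq I) (P : pred I) (F : I -> set X) :
  (forall i, measurable (F i)) ->
  (mu (\big[setU/set0]_(i <- s | P i) F i) <= \sum_(i <- s | P i) mu (F i))%E.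
Proof.
move=> mF; elim: s => [|i s IH]; first by rewrite !big_nil measure0.
rewrite !big_cons; case: ifP => // _.
apply: le_trans (measureU2 _ _ _) (leeD2l _ IH) => //.
by apply: bigsetU_measurable.
Qed.

(** * Overlaps of superlevel sets and disjoint pieces *)

Section restricted_estimates.
Context d {X : measurableType d} {R : realType} (mu : {measure set X -> \bar R}).
Implicit Types (S : set X -> X -> \bar R) (E F : set X).
Variables (S S' : set X -> X -> \bar R) (al be : R).
Hypotheses (S0 : nonneg_measurable S) (S'0 : nonneg_measurable S').
Hypothesis SS' : adjoint mu S S'.
Hypotheses (be0 : 0 < be) (be1 : be < 1) (al1 : al < 1) (abgt1 : 1 < al + be).

Lemma pairing_setID E F G : measurable E -> measurable F -> measurable G ->
  (\int[mu]_(x in F) S E x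
     = \int[mu]_(x in F `&` G) S E x + \int[mu]_(x in F `\` G) S E x)%E.
Proof.
move=> mE mF mG; rewrite -[in LHS](setUIDK F G) ge0_integral_setU//.
- exact: measurableI.
- exact: measurableD.
- exact: measurable_funTS (S0 mE).1.
- by move=> t _; apply: (S0 mE).2.
- by apply/disj_setPS => t -[[_ ?] [_]].
Qed.

(** The estimate is applied at the given heights. The larger set has the larger height because
    [al > 0] and the smaller density because [al < 1], as the ordering conditions demand. The
    logarithm of [x2 / x1] then enters with the coefficient [w2 * al - w4 * (1 - al) - 1], whose
    positivity is the decay in the ratio of sizes. *)
Lemma overlap_bound_of_estimate : two_set_estimate mu S al be ->
  exists C B th, [/\ 0 < C, 0 < th & overlap_bound mu S al be C B th].
Proof.
have g0 : 0 < al + be - 1 by rewrite subr_gt0.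
have b1 : 0 < 1 - be by rewrite subr_gt0.
have al0 : 0 < al by move: abgt1 be1; lra.
move=> [C [L [hL h]]].
set c := Num.max C 1; have c1 : 0 < c by rewrite lt_max ltr01 orbT.
have [lc cE] := gt0_expR c1.
have [|t t0 ht] := @seq_pos_lower_bound R _
  (fun w : R * R * R * R => w.1.1.2 * al - w.2 * (1 - al) - 1) L.
  by move=> [[[w1 w2] w3] w4] /hL[].
set p2 := (1 - be) / (al + be - 1); have p20 : 0 < p2 by rewrite divr_gt0.
exists (expR (lc / p2)), ((1 - be)^-1), (t / p2).
split; [exact: expR_gt0|exact: divr_gt0|].
move=> E1 E2 F e x1 x2 y mE1 mE2 mF e0 x10 x12 y0 Ex1 Ex2 Fy aS1 aS2.
have x20 : 0 < x2 by exact: lt_le_trans x12.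
have [F0|F0] := eqVneq (mu F) 0%E.
  by rewrite F0 lee_fin !mulr_ge0 ?powR_ge0 ?expR_ge0// ltW.
have {}F0 : (0 < mu F)%E by rewrite lt0e F0 measure_ge0.
have muf Y z : (mu Y <= z%:E)%E -> (0 < mu Y)%E ->
    (0 < mu Y < +oo)%E /\ exists2 m, 0 < m & mu Y = m%:E /\ m <= z.
  move=> Yz Y0; have Yf : mu Y \is a fin_num.
    by rewrite ge0_fin_numE// (le_lt_trans Yz) ?ltry.
  split; first by rewrite Y0 (le_lt_trans Yz) ?ltry.
  exists (fine (mu Y)); first by rewrite fine_gt0// Y0 /= -ge0_fin_numE.
  by rewrite -lee_fin fineK.
have [Fb [f f0 [fE fy]]] := muf _ _ Fy F0.
(* The density is computed with the bound [x] in place of the measure of [E]. This only lowers it,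
   and makes it an exact power that can be ordered. *)
have side E x : measurable E -> 0 < x -> (mu E <= x%:E)%E ->
    (forall t, F t -> ((e * (x `^ al * y `^ (be - 1)))%:E <= S E t)%E) ->
    let a := e * (x `^ al * y `^ (be - 1)) in
    [/\ (0 < mu E < +oo)%E, fine (mu E) <= x, 0 < a, 0 < a * f / x &
    ((a * f / x)%:E <= (\int[mu]_(t in F) S E t) * ((fine (mu E))^-1)%:E)%E].
  move=> mE xx0 Ex aS a.
  have a0 : 0 < a by rewrite mulr_gt0// mulr_gt0 ?powR_gt0.
  have afi : ((a * f)%:E <= \int[mu]_(t in F) S E t)%E.
    by rewrite EFinM -fE; apply: pairing_ge => //; apply: ltW.
  have [|Eb [m m0 [mEE mx]]] := muf _ _ Ex.
    apply: (pairing_gt0 S'0 SS' mE mF); apply: lt_le_trans afi.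
    by rewrite lte_fin mulr_gt0.
  split => //; first by rewrite mEE.
    by rewrite divr_gt0// mulr_gt0.
  apply: (@le_trans _ _ ((a * f)%:E * (m^-1)%:E)%E).
    by rewrite -EFinM lee_fin ler_wpM2l ?lef_pV2// ltW// mulr_gt0.
  by rewrite mEE/= lee_wpmul2r// lee_fin invr_ge0 ltW.
have [Eb1 _ a10 b10 hb1] := side _ _ mE1 x10 Ex1 aS1.
have [Eb2 mx2 a20 b20 hb2] := side _ _ mE2 x20 Ex2 aS2.
set a1 := e * (x1 `^ al * _) in aS1 a10 b10 hb1.
set a2 := e * (x2 `^ al * _) in aS2 a20 b20 hb2.
have [z1 z1E] := gt0_expR x10; have [z2 z2E] := gt0_expR x20.
have [k kE] := gt0_expR y0; have [phi phiE] := gt0_expR f0.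
have [ep epE] := gt0_expR e0.
have z12 : z1 <= z2 by rewrite -ler_expR -z1E -z2E.
have a1E : a1 = expR (ep + al * z1 + (be - 1) * k).
  by rewrite /a1 epE z1E kE !powR_expR -!expRD addrA.
have a2E : a2 = expR (ep + al * z2 + (be - 1) * k).
  by rewrite /a2 epE z2E kE !powR_expR -!expRD addrA.
have b1E : a1 * f / x1 = expR (ep + al * z1 + (be - 1) * k + phi - z1).
  by rewrite a1E phiE z1E -expRN -!expRD.
have b2E : a2 * f / x2 = expR (ep + al * z2 + (be - 1) * k + phi - z2).
  by rewrite a2E phiE z2E -expRN -!expRD.
have a12 : a1 <= a2.
  by rewrite a1E a2E ler_expR lerD2r lerD2l ler_wpM2l// ltW.
have b12 : a2 * f / x2 <= a1 * f / x1.
  rewrite b1E b2E ler_expR -subr_ge0.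
  have : 0 <= (1 - al) * (z2 - z1) by rewrite mulr_ge0// subr_ge0// ltW.
  move=> /le_trans; apply.
  by rewrite le_eqVlt; apply/orP; left; apply/eqP; ring.
have [[[[w1 w2] w3] w4] wL] := h _ _ _ _ _ _ _ mE1 mE2 mF Eb1 Eb2 Fb a10 a20 b10 b20
  aS1 aS2 hb1 hb2 a12 b12.
have /= tw := ht _ wL; have [w12 w34 _] := hL _ wL.
move=> hw.
have {}hw : a1 `^ w1 * a2 `^ w2 * (a1 * f / x1) `^ w3 * (a2 * f / x2) `^ w4 <= c * x2.
  apply: le_trans hw _; apply: (@le_trans _ _ (c * fine (mu E2))).
    by rewrite ler_wpM2r ?fine_ge0// le_max lexx.
  by rewrite ler_wpM2l// ltW.
move: hw; rewrite b1E b2E a1E a2E cE z2E !powR_expR -!expRD ler_expR => hw.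
rewrite fE lee_fin phiE epE z1E ?z2E kE -expRN -!expRD !powR_expR -!expRD ler_expR.
have w4E : w4 = p2 - w3 by rewrite /p2 -w34 addrAC subrr add0r.
have w2E : w2 = be / (al + be - 1) - w1 by rewrite -w12 addrAC subrr add0r.
(* The estimate in logarithmic form: [ep], [phi - k] and [z2 - z1] stand for [e], the measure of [F]
   relative to [y], and [x2 / x1]. The first two coefficients depend only on the prescribed sums of
   exponents. *)
have key : ep / (al + be - 1) + p2 * (phi - k)
    + (w2 * al - w4 * (1 - al) - 1) * (z2 - z1) <= lc.
  rewrite -(lerD2r z2); apply: le_trans hw.
  rewrite le_eqVlt; apply/orP; left; apply/eqP.
  by rewrite w4E w2E /p2; field; rewrite gt_eqF.
have {}key : ep / (al + be - 1) + p2 * (phi - k) + t * (z2 - z1) <= lc.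
  apply: le_trans key; rewrite lerD2l ler_wpM2r// subr_ge0//.
rewrite -(ler_pM2l p20) -subr_ge0.
move: key; rewrite -subr_ge0 => /le_trans; apply.
by rewrite le_eqVlt; apply/orP; left; apply/eqP; rewrite /p2; field; rewrite !gt_eqF.
Qed.

Section disjointification.
Variables (C1 C2 B th : R).
Hypotheses (C10 : 0 < C1) (C20 : 0 < C2) (th0 : 0 < th).
Hypotheses (rb : restricted_bound mu S al be C1) (ob : overlap_bound mu S al be C2 B th).

(** Each piece is a superlevel set of [S (E j)] in [F] minus the superlevel sets of smaller indices.
    Relative to the assumed lower bound of the pairing, at most one half is lost below the level and
    at most one quarter on the overlaps, so a quarter of the pairing remains. The gap must grow
    linearly in [m] so that the geometric decay in the gap beats the power 2^(m B) lost in the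
    overlap bound. *)
Lemma disjointify : exists A0 : nat, forall (m A : nat) (P : pred nat) (E : nat -> set X) F (x0 y : R),
  (A0 * m.+1 <= A)%N -> 0 < x0 -> 0 < y ->
  (forall j, measurable (E j)) -> measurable F ->
  (forall j, mu (E j) <= (x0 * 2 ^+ j)%:E)%E -> (mu F <= y%:E)%E ->
  (forall i j, P i -> P j -> (i < j)%N -> (i + A <= j)%N) ->
  (forall j, P j -> ((2 ^- m * ((x0 * 2 ^+ j) `^ al * y `^ be))%:E
     <= \int[mu]_(t in F) S (E j) t)%E) ->
  exists G : nat -> set X, [/\ forall j, measurable (G j), forall j, G j `<=` F,
    trivIset [set j | P j] G &
    forall j, P j -> (\int[mu]_(t in F) S (E j) t
                        <= 4%:E * \int[mu]_(t in G j) S (E j) t)%E].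
Proof.
pose l2 : R := ln 2; have l20 : 0 < l2 by rewrite ln_gt0// ltr1n.
have two : 2 = expR l2 :> R by rewrite lnK// posrE.
pose q : R := expR (- (th * l2)).
have q01 : 0 < q < 1 by rewrite expR_gt0/= expR_lt1 oppr_lt0 mulr_gt0.
have q1' : 0 < 1 - q by rewrite subr_gt0; case/andP: q01.
have [c1 c1E] := gt0_expR C10; have [c2 c2E] := gt0_expR C20.
have [cq cqE] := gt0_expR q1'.
(* Collects all constants so that [K * m.+1] dominates the logarithmic loss; the last term uses m +
   2 <= 2 (m + 1). *)
pose K := `|c1 + be * c2 - be * cq| + `|be * B * l2| + 2 * l2.
have tb0 : 0 < th * be * l2 by rewrite !mulr_gt0.
have K0 : 0 <= K by rewrite !addr_ge0// mulr_ge0// ltW.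
exists (Num.truncn (K / (th * be * l2))).+1.
move=> m A P E F x0 y hA x00 y0 mE mF Ex Fy gap lower.
have {}hA : K * m.+1%:R <= th * be * l2 * A%:R.
  rewrite -ler_pdivrMl// mulrA; apply: (@le_trans _ _ ((Num.truncn (K / (th * be * l2))).+1 * m.+1)%:R).
    rewrite natrM ler_wpM2r// mulrC ltW// truncnS_gt// divr_ge0// ltW//.
  by rewrite ler_nat.
pose xj j := x0 * 2 ^+ j; have xj0 j : 0 < xj j by rewrite mulr_gt0// exprn_gt0.
pose lam j := 2 ^- m / 2 * (xj j `^ al * y `^ (be - 1)).
have eps0 : 0 < 2 ^- m / 2 :> R by rewrite divr_gt0// invr_gt0 exprn_gt0.
have lam0 j : 0 < lam j by rewrite mulr_gt0// mulr_gt0 ?powR_gt0.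
pose G0 j := F `&` [set t | ((lam j)%:E <= S (E j) t)%E].
have mG0 j : measurable (G0 j).
  by apply: emeasurable_fun_c_infty => //; apply: measurable_funTS; apply: (S0 (mE j)).1.
pose U j := \big[setU/set0]_(i < j | P i) G0 i.
have mU j : measurable (U j) by apply: bigsetU_measurable.
have finF j : (\int[mu]_(t in F) S (E j) t)%E \is a fin_num.
  rewrite ge0_fin_numE; last exact: pairing_ge0.
  by apply: le_lt_trans (rb (mE j) mF (xj0 j) y0 (Ex j) Fy) _; rewrite ltry.
exists (fun j => G0 j `\` U j); split.
- by move=> j; apply: measurableD.
- by move=> j t [[]].
- apply/trivIsetP => i j /= Pi Pj.
  wlog ij : i j Pi Pj / (i < j)%N => [hw|_].
    rewrite neq_ltn => /orP[|] ij; first by apply: hw => //; rewrite ltn_eqF.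
    by rewrite setIC; apply: hw => //; rewrite ltn_eqF.
  rewrite -subset0 => t [[Gi _] [_]]; apply.
  by rewrite /U (bigD1 (Ordinal ij))//=; left.
move=> j Pj.
set I := (\int[mu]_(t in F) S (E j) t)%E.
have I0 : (0 <= I)%E by apply: pairing_ge0.
have low := lower _ Pj; rewrite -/I -/(xj j) in low.
set w := xj j `^ al * y `^ be in low.
have w0 : 0 < w by rewrite mulr_gt0 ?powR_gt0.
have bad1 : (\int[mu]_(t in F `\` G0 j) S (E j) t <= (2 ^- m / 2 * w)%:E)%E.
  apply: (@le_trans _ _ ((lam j)%:E * mu (F `\` G0 j))%E).
    apply: pairing_le => //; [exact: measurableD|exact: ltW|move=> t [Ft nG]].
    by apply: ltW; rewrite ltNge; apply/negP => tl; apply: nG.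
  apply: (@le_trans _ _ ((lam j)%:E * y%:E)%E).
    rewrite lee_wpmul2l ?lee_fin ?(ltW (lam0 j))//; apply: le_trans Fy.
    by apply: le_measure; rewrite ?inE; [exact: measurableD|exact: mF|exact: subDsetl].
  rewrite -EFinM lee_fin /lam /w -!mulrA -(mulrC y) mulr_powRB1// ltW//.
have overlap i : P i -> (i < j)%N ->
    (mu (G0 j `&` G0 i) <= (C2 * (2 ^- m / 2) `^ (- B) * y * q ^+ (j - i))%:E)%E.
  move=> Pi ij.
  apply: le_trans (ob (E1 := E i) (E2 := E j) (mE i) (mE j) _ eps0 (xj0 i) _ y0 (Ex i) (Ex j) _ _ _) _.
  - exact: measurableI.
  - by rewrite ler_pM2l// ler_eXn2l ?ltr1n// ltnW.
  - apply: le_trans Fy; apply: le_measure; rewrite ?inE//; first exact: measurableI.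
    by move=> t [[]].
  - by move=> t [_ []].
  - by move=> t [[]].
  - rewrite lee_fin le_eqVlt; apply/orP; left; apply/eqP.
    rewrite mulrAC; congr (_ * _).
    rewrite /xj -mulf_div divff ?gt_eqF// mul1r.
    have -> : 2 ^+ i / 2 ^+ j = 2 ^- (j - i) :> R.
      by rewrite -{1}(subnK (ltnW ij)) exprD invfM mulrCA divff ?mulr1// expf_neq0.
    rewrite /q two -!expRM_natl -expRN powR_expR; congr expR; ring.
(* Bounds the overlap with all earlier sets together: by the gap the geometric series in [j - i]
   starts at [A]. *)
pose z := C2 * (2 ^- m / 2) `^ (- B) * y * (q ^+ A / (1 - q)).
have z0 : 0 < z.
  by rewrite !mulr_gt0 ?powR_gt0 ?invr_gt0// exprn_gt0//; case/andP: q01.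
have muU : (mu (G0 j `&` U j) <= z%:E)%E.
  rewrite /U big_distrr/=.
  apply: (@le_trans _ _ (\sum_(i < j | P i) mu (G0 j `&` G0 i))%E).
    by apply: measure_bigsetU_le => i; apply: measurableI.
  apply: (@le_trans _ _ (\sum_(i < j | P i) (C2 * (2 ^- m / 2) `^ (- B) * y * q ^+ (j - i))%:E)%E).
    by apply: lee_sum => i Pi; apply: overlap.
  rewrite sumEFin lee_fin -mulr_sumr /z ler_wpM2l//.
    by rewrite !mulr_ge0 ?powR_ge0// ltW.
  apply: le_trans (geometric_tail_le A j q01).
  rewrite [leLHS]big_mkcond [leRHS]big_mkcond/=; apply: ler_sum => i _.
  have q0 k : 0 <= q ^+ k by rewrite exprn_ge0// ltW//; case/andP: q01.
  case: ifPn => Pi; last by case: ifP.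
  by rewrite leq_subRL ?gap// ltnW.
have bad2 : (\int[mu]_(t in G0 j `&` U j) S (E j) t <= (2 ^- m / 4 * w)%:E)%E.
  apply: le_trans (rb (mE j) _ (xj0 j) z0 (Ex j) muU) _; first exact: measurableI.
  rewrite lee_fin /w mulrCA [leRHS]mulrCA ler_pM2l ?powR_gt0//.
  have [k kE] := gt0_expR y0.
  have -> : 2 ^- m / 4 = expR (- (m.+2%:R * l2)) :> R.
    have -> : 4 = 2 ^+ 2 :> R by rewrite -natrX.
    by rewrite -invfM -exprD addn2 two -expRM_natl expRN.
  have -> : z = expR (c2 + B * (m.+1%:R * l2) + k - A%:R * (th * l2) - cq).
    rewrite /z c2E -invfM -exprSr two kE cqE /q -!expRM_natl -!expRN powR_expR -!expRD.
    by congr expR; ring.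
  rewrite c1E kE !powR_expR -!expRD ler_expR.
  have : c1 + be * c2 - be * cq + be * B * l2 * m.+1%:R + m.+2%:R * l2 <= K * m.+1%:R.
    have m1 : 1 <= m.+1%:R :> R by rewrite ler1n.
    rewrite /K (mulrDl _ (2 * l2)) (mulrDl `|_|); apply: lerD; first apply: lerD.
    - by apply: le_trans (ler_norm _) _; rewrite ler_peMr.
    - by rewrite ler_wpM2r// ler_norm.
    - rewrite mulrAC ler_wpM2r ?(ltW l20)// -natrM ler_nat mul2n -addnn addSn addnS.
      by rewrite !ltnS leq_addr.
  move=> /le_trans/(_ hA); lra.
have IE : (I = \int[mu]_(t in G0 j `\` U j) S (E j) t +
  \int[mu]_(t in G0 j `&` U j) S (E j) t + \int[mu]_(t in F `\` G0 j) S (E j) t)%E.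
  rewrite /I (pairing_setID (mE j) mF (mG0 j)).
  have -> : F `&` G0 j = G0 j by rewrite /G0 setIA setIid.
  by rewrite (pairing_setID (mE j) (mG0 j) (mU j)) [X in (X + _)%E]addeC.
set J := (\int[mu]_(t in G0 j `\` U j) S (E j) t)%E in IE *.
have hJ : (I <= J + (3 / 4 * 2 ^- m * w)%:E)%E.
  rewrite IE -addeA leeD2l//; apply: le_trans (leeD bad2 bad1) _.
  by rewrite -EFinD lee_fin; lra.
have J0 : (0 <= J)%E by apply: pairing_ge0.
have [->|/eqP Joo] := eqVneq J +oo%E; first by rewrite gt0_muley ?lte_fin// leey.
have Jf : J \is a fin_num by rewrite ge0_fin_numE// ltey; apply/eqP.
have If : I \is a fin_num by exact: finF.
move: low hJ; rewrite -(fineK If) -(fineK Jf) -EFinD -EFinM !lee_fin; lra.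
Qed.

End disjointification.
End restricted_estimates.

(** * The bilinear estimate *)

Section real_sums.
Context {R : realType}.
Implicit Types p t : R.

Lemma young_powR p (a b : R) : 0 < p < 1 -> 0 <= a -> 0 <= b ->
  a * b <= a `^ p^-1 + b `^ (1 - p)^-1.
Proof.
move=> /andP[p0 p1] a0 b0; have q0 : 0 < 1 - p by rewrite subr_gt0.
have pq : p^-1^-1 + (1 - p)^-1^-1 = 1 by rewrite !invrK addrC subrK.
apply: le_trans (conjugate_powR a0 b0 _ _ pq) _; rewrite ?invr_gt0//.
rewrite !invrK; apply: lerD; rewrite ler_piMr ?powR_ge0// ?(ltW p1)//; lra.
Qed.

(** Young's inequality is applied to (x phi^p)(y theta^(1-p)). One term carries [phi] to the first
    power and is summed over [k], the other carries [theta] and is summed over [j]. *)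
Lemma young_sum p (N N' : nat) (Q : nat -> nat -> bool) (x y : nat -> R)
    (phi theta : nat -> nat -> R) : 0 < p < 1 ->
  (forall j, 0 <= x j) -> (forall k, 0 <= y k) ->
  (forall j k, 0 <= phi j k) -> (forall j k, 0 <= theta j k) ->
  (forall j, \sum_(k < N' | Q j k) phi j k <= 1) ->
  (forall k, \sum_(j < N | Q j k) theta j k <= 1) ->
  \sum_(j < N) \sum_(k < N' | Q j k) x j * y k * (phi j k `^ p * theta j k `^ (1 - p))
    <= \sum_(j < N) x j `^ p^-1 + \sum_(k < N') y k `^ (1 - p)^-1.
Proof.
move=> p01 x0 y0 phi0 th0 sphi sth; have /andP[p0 p1] := p01.
have q0 : 0 < 1 - p by rewrite subr_gt0.
apply: (@le_trans _ _ (\sum_(j < N) \sum_(k < N' | Q j k)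
    (x j `^ p^-1 * phi j k + y k `^ (1 - p)^-1 * theta j k))).
  apply: ler_sum => j _; apply: ler_sum => k _.
  rewrite mulrACA; apply: le_trans (young_powR p01 _ _) _; rewrite ?mulr_ge0 ?powR_ge0//.
  by rewrite !powRM ?powR_ge0// -!powRrM !divff ?gt_eqF// !powRr1.
under eq_bigr do rewrite big_split/=.
rewrite big_split/=; apply: lerD.
  apply: ler_sum => j _; rewrite -mulr_sumr ler_piMr ?powR_ge0//.
rewrite (exchange_big_dep xpredT)//=; apply: ler_sum => k _.
by rewrite -mulr_sumr ler_piMr ?powR_ge0.
Qed.

Lemma ler_powR_le1 (a b c : R) : 0 <= a <= 1 -> 0 < c -> c <= b -> a `^ b <= a `^ c.
Proof.
move=> /andP[]; rewrite le_eqVlt => /predU1P[<- _ c0 cb|a0 a1 c0 cb].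
  by rewrite !powR0// gt_eqF// (lt_le_trans c0).
by apply: ger_powR => //; rewrite a0.
Qed.

(** [M] is the product of its powers [t] and [1 - t], each estimated by one of the two bounds. As
    [phi] and [th] lie in [0, 1], their exponents may be lowered to p and 1 - p; [a ^ t] is the gain
    kept for the sum over levels. *)
Lemma interpolate_powR (p t al be M a D phi th : R) :
  0 < p < 1 -> 0 < t < 1 -> p <= al * (1 - t) -> 1 - p <= be * (1 - t) ->
  0 <= phi <= 1 -> 0 <= th <= 1 -> 0 <= M -> 0 <= D -> M <= a ->
  M <= D * (phi `^ al * th `^ be) ->
  M <= a `^ t * D `^ (1 - t) * (phi `^ p * th `^ (1 - p)).
Proof.
move=> /andP[p0 p1] /andP[t0 t1] pal pbe phi01 th01 M0 D0 Ma MD.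
have t1' : 0 < 1 - t by rewrite subr_gt0.
have a0 := le_trans M0 Ma; have B0 := le_trans M0 MD.
have -> : M = M `^ t * M `^ (1 - t).
  by rewrite -powRD ?subrKC ?powRr1// oner_eq0.
rewrite -mulrA; apply: ler_pM; rewrite ?powR_ge0//.
  by apply: ge0_ler_powR; rewrite ?nnegrE// ltW.
apply: (@le_trans _ _ ((D * (phi `^ al * th `^ be)) `^ (1 - t))).
  by apply: ge0_ler_powR; rewrite ?nnegrE// ltW.
rewrite !powRM ?mulr_ge0 ?powR_ge0// -!powRrM ler_wpM2l ?powR_ge0//.
by apply: ler_pM; rewrite ?powR_ge0//; apply: ler_powR_le1 => //; rewrite subr_gt0.
Qed.

(** The square counts pairs of residue classes at level [m]. Half of the exponential decay absorbs
    it through z <= exp z, and a geometric series remains. *)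
Lemma sum_square_geometric (l : R) : 0 < l -> exists2 K, 0 < K &
  forall M : nat, \sum_(m < M) (m + 4)%:R ^+ 2 * expR (- (4 * l)) ^+ m <= K.
Proof.
move=> l0; pose q : R := expR (- (2 * l)).
have q1 : 0 < 1 - q by rewrite subr_gt0 expR_lt1 oppr_lt0 mulr_gt0.
exists (expR (8 * l) / l ^+ 2 / (1 - q)); first by rewrite !divr_gt0 ?expR_gt0 ?exprn_gt0.
move=> M; apply: (@le_trans _ _ (\sum_(m < M) expR (8 * l) / l ^+ 2 * q ^+ m)).
  apply: ler_sum => m _.
  set e := expR ((m + 4)%:R * l).
  have h : (m + 4)%:R * l <= e.
    by apply: le_trans (expR_ge1Dx _); rewrite ler_wpDl.
  have {}h : ((m + 4)%:R * l) ^+ 2 <= e ^+ 2.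
    by rewrite ler_pXn2r// nnegrE ?expR_ge0// mulr_ge0// ltW.
  have {}h : (m + 4)%:R ^+ 2 <= e ^+ 2 / l ^+ 2.
    by rewrite ler_pdivlMr ?exprn_gt0// -exprMn.
  apply: le_trans (ler_wpM2r _ h) _; first by rewrite exprn_ge0// expR_ge0.
  rewrite le_eqVlt; apply/orP; left; apply/eqP.
  rewrite mulrAC [RHS]mulrAC; congr (_ / _).
  by rewrite /e /q -!expRM_natl -!expRD natrD; congr expR; ring.
rewrite -mulr_sumr ler_wpM2l//; first by rewrite divr_ge0 ?expR_ge0// exprn_ge0// ltW.
have q0 : 0 <= q by exact: expR_ge0.
rewrite -[leRHS]mul1r ler_pdivlMr// mulrC.
suff -> : (1 - q) * (\sum_(m < M) q ^+ m) = 1 - q ^+ M by rewrite gerBl exprn_ge0.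
elim: (M) => [|n IH]; first by rewrite big_ord0 mulr0 expr0 subrr.
by rewrite big_ord_recr/= mulrDr IH exprS; ring.
Qed.

End real_sums.

(** * Factorization on separated indices *)

Section bilinear.
Context d {X : measurableType d} {R : realType} (mu : {measure set X -> \bar R}).
Variables (S S' : set X -> X -> \bar R) (al be : R).
Hypotheses (S0 : nonneg_measurable S) (S'0 : nonneg_measurable S').
Hypothesis SS' : adjoint mu S S'.
Hypotheses (al1 : al < 1) (be1 : be < 1) (abgt1 : 1 < al + be).
Hypothesis est : two_set_estimate mu S al be.
Hypothesis est' : two_set_estimate mu S' be al.

Lemma adjoint_sym : adjoint mu S' S.
Proof. by move=> E F mE mF; rewrite SS'. Qed.

Lemma restricted_bound_fine C E F : restricted_bound mu S al be C -> 0 <= C ->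
  measurable E -> measurable F -> (mu E < +oo)%E -> (mu F < +oo)%E ->
  (\int[mu]_(t in F) S E t
     <= (C * (fine (mu E) `^ al * fine (mu F) `^ be))%:E)%E.
Proof.
move=> rb C0 mE mF Eoo Foo.
have rhs0 : (0 <= (C * (fine (mu E) `^ al * fine (mu F) `^ be))%:E)%E.
  by rewrite lee_fin !mulr_ge0 ?powR_ge0.
have Ef : mu E \is a fin_num by rewrite ge0_fin_numE.
have Ff : mu F \is a fin_num by rewrite ge0_fin_numE.
have [E0|E0] := eqVneq (mu E) 0%E; first by rewrite (pairing_null S'0 SS').
have [F0|F0] := eqVneq (mu F) 0%E.
  by rewrite SS'// (pairing_null S0 adjoint_sym).
by apply: rb; rewrite ?fineK// fine_gt0// ?Eoo ?Foo lt0e ?E0 ?F0 measure_ge0.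
Qed.

Lemma disjoint_fine_sum_le (E : set X) (x : R) (G : nat -> set X) (P : pred nat) N :
  measurable E -> 0 < x -> (mu E <= x%:E)%E -> (forall j, measurable (G j)) ->
  (forall j, G j `<=` E) -> trivIset [set j | P j] G ->
  \sum_(j < N | P j) fine (mu (G j)) / x <= 1.
Proof.
move=> mE x0 Ex mG GE tG.
have Gf j : mu (G j) \is a fin_num.
  rewrite ge0_fin_numE//; apply: le_lt_trans (ltry x); apply: le_trans Ex.
  by apply: le_measure; rewrite ?inE.
rewrite -mulr_suml ler_pdivrMr// mul1r -lee_fin -sumEFin.
under eq_bigr do rewrite fineK//.
rewrite -(@measure_bigsetU_ord_cond _ _ _ mu N (fun i => P i) (fun i => G i))//.
  apply: le_trans Ex; apply: le_measure; rewrite ?inE//.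
    by apply: bigsetU_measurable.
  by elim/big_ind: _ => [//|A B AE BE t [/AE|/BE]|i _ t /GE].
by move=> i j Pi Pj ij; apply: val_inj; apply: tG.
Qed.

(** Two successive disjointifications: [G k j] inside [F k], disjoint in [j], then [H j k] inside
    [E j], disjoint in [k]. Each costs a factor 4, and the restricted bound for [H j k] and [G k j]
    gives the factorization with [D = 16 * C]. *)
Lemma separated_factorization : exists (A0 : nat) (D : R), 0 < D /\
  forall (m A : nat) (Q : nat -> nat -> bool) (E F : nat -> set X) (x0 y0 : R),
  (A0 * (m + 4) <= A)%N -> 0 < x0 -> 0 < y0 ->
  (forall j, measurable (E j)) -> (forall k, measurable (F k)) ->
  (forall j, mu (E j) <= (x0 * 2 ^+ j)%:E)%E ->
  (forall k, mu (F k) <= (y0 * 2 ^+ k)%:E)%E ->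
  (forall i j k, Q i k -> Q j k -> (i < j)%N -> (i + A <= j)%N) ->
  (forall i j k, Q i j -> Q i k -> (j < k)%N -> (j + A <= k)%N) ->
  (forall j k, Q j k -> ((2 ^- m.+1 * ((x0 * 2 ^+ j) `^ al * (y0 * 2 ^+ k) `^ be))%:E
     <= \int[mu]_(t in F k) S (E j) t)%E) ->
  exists phi theta : nat -> nat -> R,
  [/\ (forall j k, 0 <= phi j k <= 1) /\ (forall j k, 0 <= theta j k <= 1),
      forall N j, \sum_(k < N | Q j k) phi j k <= 1,
      forall N k, \sum_(j < N | Q j k) theta j k <= 1 &
      forall j k, Q j k -> (\int[mu]_(t in F k) S (E j) t <=
        (D * (phi j k `^ al * theta j k `^ be)
           * ((x0 * 2 ^+ j) `^ al * (y0 * 2 ^+ k) `^ be))%:E)%E].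
Proof.
have al0 : 0 < al by move: be1 abgt1; lra.
have be0 : 0 < be by move: al1 abgt1; lra.
have abgt1' : 1 < be + al by rewrite addrC.
have [C C0 rb] := restricted_bound_of_estimate S0 S'0 SS' be1 abgt1 est.
have [C' C'0 rb'] := restricted_bound_of_estimate S'0 S0 adjoint_sym al1 abgt1' est'.
have [C2 [B [th [C20 th0 ob]]]] := overlap_bound_of_estimate S0 S'0 SS' be1 al1 abgt1 est.
have [C2' [B' [th' [C20' th0' ob']]]] :=
  overlap_bound_of_estimate S'0 S0 adjoint_sym al1 be1 abgt1' est'.
have [A1 dj] := disjointify S0 be0 C0 C20 th0 rb ob.
have [A2 dj'] := disjointify S'0 al0 C'0 C20' th0' rb' ob'.
exists (A1 + A2)%N, (16 * C); split; first by rewrite mulr_gt0.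
move=> m A Q E F x0 y0 hA x00 y00 mE mF Ex Fy gapj gapk lower.
have hA1 : (A1 * m.+2 <= A)%N by apply: leq_trans hA; rewrite leq_mul ?leq_addr// -addn2 leq_add2l.
have hA2 : (A2 * m.+4 <= A)%N by apply: leq_trans hA; rewrite leq_mul ?leq_addl// addn4.
have xj0 j : 0 < x0 * 2 ^+ j by rewrite mulr_gt0// exprn_gt0.
have yk0 k : 0 < y0 * 2 ^+ k by rewrite mulr_gt0// exprn_gt0.
have /choice[G hG] k := dj m.+1 A (Q^~ k) E (F k) x0 (y0 * 2 ^+ k)
  hA1 x00 (yk0 k) mE (mF k) Ex (Fy k) (fun i j => @gapj i j k) (fun j => @lower j k).
have mG k j : measurable (G k j) by case: (hG k).
have Gy k j : (mu (G k j) <= (y0 * 2 ^+ k)%:E)%E.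
  by apply: le_trans (Fy k); apply: le_measure; rewrite ?inE//; case: (hG k).
(* The second application pairs [E j] with [G k j] instead of [F k]. The first one cost a factor 4,
   so the level drops from [m.+1] to [m.+3], whence [m + 4] in the condition on the gap. *)
have low2 j k : Q j k ->
    ((2 ^- m.+3 * ((y0 * 2 ^+ k) `^ be * (x0 * 2 ^+ j) `^ al))%:E
       <= \int[mu]_(t in E j) S' (G k j) t)%E.
  move=> Qjk; rewrite -SS'//; have [_ _ _ /(_ _ Qjk)] := hG k.
  move=> /(le_trans (lower _ _ Qjk)).
  rewrite -lee_pdivrMl// -EFinM; apply: le_trans.
  rewrite lee_fin le_eqVlt; apply/orP; left; apply/eqP.
  by rewrite !exprS !invfM; field; rewrite expf_neq0.
have /choice[H hH] j := dj' m.+3 A (Q j) (fun k => G k j) (E j) y0 (x0 * 2 ^+ j)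
  hA2 y00 (xj0 j) (mG^~ j) (mE j) (Gy^~ j) (Ex j) (fun i k => @gapk j i k) (low2 j).
have mH j k : measurable (H j k) by case: (hH j).
have Hx j k : (mu (H j k) <= (x0 * 2 ^+ j)%:E)%E.
  by apply: le_trans (Ex j); apply: le_measure; rewrite ?inE//; case: (hH j).
pose phi j k := fine (mu (H j k)) / (x0 * 2 ^+ j).
pose theta j k := fine (mu (G k j)) / (y0 * 2 ^+ k).
have fin_le (Y : set X) (z : R) : (mu Y <= z%:E)%E -> mu Y \is a fin_num.
  by move=> Yz; rewrite ge0_fin_numE// (le_lt_trans Yz) ?ltry.
exists phi, theta; split.
- split=> j k.
    rewrite /phi divr_ge0 ?fine_ge0 ?(ltW (xj0 j))//= ler_pdivrMr// mul1r -lee_fin.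
    by rewrite fineK// (fin_le _ _ (Hx j k)).
  rewrite /theta divr_ge0 ?fine_ge0 ?(ltW (yk0 k))//= ler_pdivrMr// mul1r -lee_fin.
  by rewrite fineK// (fin_le _ _ (Gy k j)).
- move=> N j; apply: (disjoint_fine_sum_le (P := Q j) N (mE j) (xj0 j) (Ex j) (mH j)); by case: (hH j).
- move=> N k; apply: (disjoint_fine_sum_le (P := Q^~ k) N (mF k) (yk0 k) (Fy k) (mG k)); by case: (hG k).
move=> j k Qjk.
have [_ _ _ /(_ _ Qjk) h1] := hG k; have [_ _ _ /(_ _ Qjk) h2] := hH j.
apply: le_trans h1 _; rewrite SS'//.
apply: le_trans (lee_wpmul2l _ h2) _ => //; rewrite -(SS' (mH j k) (mG k j)).
have Hf := fin_le _ _ (Hx j k); have Gf := fin_le _ _ (Gy k j).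
apply: le_trans (lee_wpmul2l _ (lee_wpmul2l _ (restricted_bound_fine rb (ltW C0) (mH j k) (mG k j) _ _))) _ => //.
- by rewrite -ge0_fin_numE.
- by rewrite -ge0_fin_numE.
rewrite -!EFinM lee_fin /phi /theta.
have := xj0 j; have := yk0 k; move: (x0 * 2 ^+ j) (y0 * 2 ^+ k) => x y yk xj.
rewrite !powRM ?fine_ge0 ?invr_ge0 ?(ltW xj) ?(ltW yk)//.
rewrite -!powR_inv1 ?(ltW xj) ?(ltW yk)// -!powRrM !mulN1r !powRN.
rewrite le_eqVlt; apply/orP; left; apply/eqP; field.
by rewrite !gt_eqF ?powR_gt0.
Qed.

End bilinear.

Lemma dyadic_level {R : realType} (z : R) : 0 < z <= 1 ->
  exists m : nat, 2 ^- m.+1 < z <= 2 ^- m.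
Proof.
move=> /andP[z0 z1].
have ex : exists m : nat, 2 ^- m.+1 < z.
  exists (Num.truncn z^-1); rewrite invf_plt ?posrE ?exprn_gt0//.
  apply: lt_le_trans (truncnS_gt _) _.
  by rewrite -natrX ler_nat ltnW// ltn_expl.
case: (ex_minnP ex) => m mz minm; exists m; rewrite mz/=.
case: m mz minm => [|m] _ minm; first by rewrite expr0 invr1.
by rewrite leNgt; apply/negP => /minm; rewrite ltnn.
Qed.

Lemma ler_sum_term {R : numDomainType} {I : finType} (f : I -> R) (i : I) :
  (forall j, 0 <= f j) -> f i <= \sum_j f j.
Proof. by move=> f0; rewrite (bigD1 i)//= lerDl sumr_ge0. Qed.

Lemma exchange_big3 {R : zmodType} (N N' n : nat) (f : nat -> nat -> nat -> R) :
  \sum_(j < N) \sum_(k < N') \sum_(i < n) f j k i =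
  \sum_(i < n) \sum_(j < N) \sum_(k < N') f j k i.
Proof.
under eq_bigr do rewrite exchange_big.
by rewrite exchange_big.
Qed.

(** * Summation over levels and residue classes *)

Section bilinear.
Context d {X : measurableType d} {R : realType} (mu : {measure set X -> \bar R}).
Variables (S S' : set X -> X -> \bar R) (al be p : R).
Hypotheses (S0 : nonneg_measurable S) (S'0 : nonneg_measurable S').
Hypothesis SS' : adjoint mu S S'.
Hypotheses (al1 : al < 1) (be1 : be < 1) (pbe : 1 - be < p) (pal : p < al).
Hypothesis est : two_set_estimate mu S al be.
Hypothesis est' : two_set_estimate mu S' be al.

Lemma bilinear_estimate : exists2 K : R, 0 < K &
  forall (E F : nat -> set X) (x0 y0 : R) (N N' : nat) (a b : nat -> R),
  0 < x0 -> 0 < y0 ->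
  (forall j, measurable (E j)) -> (forall k, measurable (F k)) ->
  (forall j, mu (E j) <= (x0 * 2 ^+ j)%:E)%E ->
  (forall k, mu (F k) <= (y0 * 2 ^+ k)%:E)%E ->
  (forall j, 0 <= a j) -> (forall k, 0 <= b k) ->
  (\sum_(j < N) \sum_(k < N') (a j * b k)%:E * \int[mu]_(t in F k) S (E j) t <=
   (K * (\sum_(j < N) (a j * (x0 * 2 ^+ j) `^ al) `^ p^-1
       + \sum_(k < N') (b k * (y0 * 2 ^+ k) `^ be) `^ (1 - p)^-1))%:E)%E.
Proof.
have p0 : 0 < p by move: be1 pbe; lra.
have p1 : p < 1 by move: al1 pal; lra.
have p01 : 0 < p < 1 by rewrite p0.
have al0 : 0 < al by move: p0 pal; lra.
have be0 : 0 < be by move: p1 pbe; lra.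
have abgt1 : 1 < al + be by move: pbe pal; lra.
have [C1 C10 rb1] := restricted_bound_of_estimate S0 S'0 SS' be1 abgt1 est.
pose C := Num.max C1 1.
have C1' : 1 <= C by rewrite le_max lexx orbT.
have C0 : 0 < C by apply: lt_le_trans C1'.
have rb : restricted_bound mu S al be C.
  move=> E F x y mE mF xx0 yy0 Ex Fy; apply: le_trans (rb1 _ _ _ _ mE mF xx0 yy0 Ex Fy) _.
  by rewrite lee_fin ler_wpM2r ?mulr_ge0 ?powR_ge0// le_max lexx.
have [A0 [D [D0 fac]]] := separated_factorization S0 S'0 SS' al1 be1 abgt1 est est'.
(* The largest [t] for which [al * (1 - t)] and [be * (1 - t)] still dominate p and 1 - p; it is
   positive because both inequalities on p are strict. *)
pose t := Num.min (1 - p / al) (1 - (1 - p) / be).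
have t0 : 0 < t.
  rewrite lt_min !subr_gt0 !ltr_pdivrMr// !mul1r pal/=; move: pbe; lra.
have t1 : t < 1.
  by rewrite gt_min gtrBl divr_gt0.
have palt : p <= al * (1 - t).
  by rewrite mulrC -ler_pdivrMr// lerBrDr addrC -lerBrDr ge_min lexx.
have pbet : 1 - p <= be * (1 - t).
  by rewrite mulrC -ler_pdivrMr// lerBrDr addrC -lerBrDr ge_min lexx orbT.
(* Chosen so that exp(- 4 l) = 2^(-t), the gain per dyadic level. *)
pose l := t * ln 2 / 4.
have l0 : 0 < l by rewrite divr_gt0// mulr_gt0// ln_gt0// ltr1n.
have [K K0 sumK] := sum_square_geometric l0.
(* The modulus at level [m]; the successor of [A0] keeps it positive. *)
pose A m := (A0.+1 * (m + 4))%N.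
have A0' m : (0 < A m)%N by rewrite /A muln_gt0 addn_gt0 orbT.
exists (A0.+1%:R ^+ 2 * C `^ t * D `^ (1 - t) * K).
  by rewrite !mulr_gt0 ?powR_gt0// exprn_gt0.
move=> E F x0 y0 N N' a b x00 y00 mE mF Ex Fy a0 b0.
have xj0 j : 0 < x0 * 2 ^+ j by rewrite mulr_gt0// exprn_gt0.
have yk0 k : 0 < y0 * 2 ^+ k by rewrite mulr_gt0// exprn_gt0.
pose w j k := (x0 * 2 ^+ j) `^ al * (y0 * 2 ^+ k) `^ be.
have w0 j k : 0 < w j k by rewrite mulr_gt0 ?powR_gt0.
pose I j k := (\int[mu]_(t in F k) S (E j) t)%E.
have I0 j k : (0 <= I j k)%E by apply: pairing_ge0.
have Iw j k : (I j k <= (C * w j k)%:E)%E by apply: rb.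
have If j k : I j k \is a fin_num by rewrite ge0_fin_numE// (le_lt_trans (Iw j k)) ?ltry.
(* The pairing relative to the restricted bound. [M j k / C] is at most 1, so it has a dyadic level
   whenever it is positive. *)
pose M j k := fine (I j k) / w j k.
have IE j k : I j k = (M j k * w j k)%:E.
  by rewrite /M divfK ?gt_eqF// fineK.
have M0 j k : 0 <= M j k by rewrite divr_ge0 ?fine_ge0// ltW.
have MC j k : M j k / C <= 1.
  by rewrite ler_pdivrMr// mul1r ler_pdivrMr// -lee_fin fineK.
clearbody M.
pose x j := a j * (x0 * 2 ^+ j) `^ al.
pose y k := b k * (y0 * 2 ^+ k) `^ be.
have xx0 j : 0 <= x j by rewrite mulr_ge0 ?powR_ge0.
have yy0 k : 0 <= y k by rewrite mulr_ge0 ?powR_ge0.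
pose T := \sum_(j < N) x j `^ p^-1 + \sum_(k < N') y k `^ (1 - p)^-1.
have T0 : 0 <= T by rewrite addr_ge0 ?sumr_ge0// => i _; apply: powR_ge0.
have -> : (\sum_(j < N) \sum_(k < N') (a j * b k)%:E * I j k)%E
    = (\sum_(j < N) \sum_(k < N') x j * y k * M j k)%:E.
  rewrite -sumEFin; apply: eq_bigr => j _; rewrite -sumEFin; apply: eq_bigr => k _.
  by rewrite IE -EFinM /x /y /w; congr EFin; ring.
rewrite lee_fin.
have /choice[mf hmf] j : exists f : nat -> nat, forall k, 0 < M j k ->
    2 ^- (f k).+1 < M j k / C <= 2 ^- f k.
  suff /choice[f hf] : forall k, exists m, 0 < M j k -> 2 ^- m.+1 < M j k / C <= 2 ^- m by exists f.
  move=> k; have [Mp|] := ltP 0 (M j k); last by exists 0%N.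
  by have [|m hm] := @dyadic_level _ (M j k / C); [rewrite MC divr_gt0|exists m].
(* A class fixes the level and the residues of both indices modulo [A m]. Distinct indices with the
   same residue differ by at least [A m], which is the separation needed for the factorization. *)
pose Q m i i' j k := [&& (0 < M j k)%R, mf j k == m, j %% A m == i & k %% A m == i']%N.
have gap n i i' c : (i %% n = c -> i' %% n = c -> i < i' -> i + n <= i')%N.
  move=> ic i'c ii'; rewrite (divn_eq i n) (divn_eq i' n) ic i'c in ii' *.
  by move: ii'; rewrite ltn_add2r ltn_mul2r => /andP[_ qq]; rewrite addnAC leq_add2r -mulSnr leq_mul2r qq orbT.
have class m i i' : \sum_(j < N) \sum_(k < N') (if Q m i i' j k then x j * y k * M j k else 0)
    <= C `^ t * D `^ (1 - t) * T * expR (- (4 * l)) ^+ m.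
  have [||||phi [th [[phi01 th01] sphi sth fac']]] := fac m (A m) (Q m i i') E F x0 y0 _ x00 y00 mE mF Ex Fy.
  - by rewrite /A leq_mul.
  - by move=> j j' k /and4P[_ _ /eqP ij _] /and4P[_ _ /eqP ij' _]; apply: gap ij ij'.
  - by move=> k j j' /and4P[_ _ _ /eqP ij] /and4P[_ _ _ /eqP ij']; apply: gap ij ij'.
  - move=> j k /and4P[Mp /eqP mm _ _]; rewrite -/(I j k) IE lee_fin ler_wpM2r ?(ltW (w0 j k))//.
    have /andP[/ltW h _] := hmf j k Mp; rewrite -mm; apply: le_trans h _.
    by rewrite ler_pdivrMr// ler_peMr.
  rewrite [leRHS]mulrAC; apply: le_trans (ler_wpM2l _ (young_sum p01 xx0 yy0
    (fun j k => proj1 (andP (phi01 j k))) (fun j k => proj1 (andP (th01 j k)))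
    (sphi N') (sth N))); last by rewrite !mulr_ge0 ?powR_ge0// exprn_ge0// expR_ge0.
  rewrite mulr_sumr; apply: ler_sum => j _; rewrite -big_mkcond mulr_sumr; apply: ler_sum => k Qjk.
  rewrite [leRHS]mulrCA; apply: ler_wpM2l; first by rewrite mulr_ge0.
  have /and4P[Mp /eqP mm _ _] := Qjk.
  have /andP[_ Mm] := hmf j k Mp; rewrite mm ler_pdivrMr// in Mm.
  have := fac' _ _ Qjk; rewrite -/(I j k) IE lee_fin ler_pM2r// => MD.
  apply: le_trans (interpolate_powR p01 _ palt pbet (phi01 j k) (th01 j k) (M0 j k) (ltW D0) Mm MD) _.
    by rewrite t0.
  rewrite le_eqVlt; apply/orP; left; apply/eqP.
  rewrite powRM ?(ltW C0)// ?invr_ge0 ?exprn_ge0//.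
  have -> : (2 ^- m) `^ t = expR (- (4 * l)) ^+ m.
    rewrite -expRM_natl -[2 in LHS]lnK ?posrE// -expRM_natl -expRN powR_expR /l.
    by congr expR; field.
  by ring.
(* The finite families involve finitely many levels; the final constant comes from [sumK], which is
   uniform in their number. *)
pose M1 := (\max_(j < N) \max_(k < N') mf j k).+1.
apply: (@le_trans _ _ (\sum_(m < M1) \sum_(i < A m) \sum_(i' < A m)
   \sum_(j < N) \sum_(k < N') (if Q m i i' j k then x j * y k * M j k else 0))).
  rewrite [leRHS](_ : _ = \sum_(j < N) \sum_(k < N') \sum_(m < M1) \sum_(i < A m) \sum_(i' < A m)
     (if Q m i i' j k then x j * y k * M j k else 0)); last first.
    rewrite (exchange_big3 _ _ _ (fun j k m => \sum_(i < A m) \sum_(i' < A m) (if Q m i i' j k then x j * y k * M j k else 0))).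
    apply: eq_bigr => m _.
    rewrite (exchange_big3 _ _ _ (fun j k i => \sum_(i' < A m) (if Q m i i' j k then x j * y k * M j k else 0))).
    apply: eq_bigr => i _.
    by rewrite (exchange_big3 _ _ _ (fun j k i' => (if Q m i i' j k then x j * y k * M j k else 0))).
  apply: ler_sum => j _; apply: ler_sum => k _.
  have nn m i i' : 0 <= (if Q m i i' j k then x j * y k * M j k else 0).
    by case: ifP => // _; rewrite mulr_ge0// mulr_ge0.
  have [Mp|Mn] := ltP 0 (M j k); last first.
    have -> : M j k = 0 by apply/eqP; rewrite eq_le Mn M0.
    by rewrite mulr0 sumr_ge0// => m _; rewrite sumr_ge0// => i _; rewrite sumr_ge0// => i' _; case: ifP.
  have mM : (mf j k < M1)%N.
    by rewrite /M1 ltnS; apply: leq_trans (leq_bigmax k) (leq_bigmax j).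
  pose m0 := Ordinal mM.
  apply: le_trans (ler_sum_term m0 _); last first.
    by move=> m; rewrite sumr_ge0// => i _; rewrite sumr_ge0.
  apply: le_trans (ler_sum_term (Ordinal (ltn_pmod j (A0' m0))) _); last first.
    by move=> i; rewrite sumr_ge0.
  apply: le_trans (ler_sum_term (Ordinal (ltn_pmod k (A0' m0))) _) => //=.
  by rewrite /Q Mp !eqxx.
apply: (@le_trans _ _ (\sum_(m < M1) (A m)%:R ^+ 2 * (C `^ t * D `^ (1 - t) * T * expR (- (4 * l)) ^+ m))).
  have sumc n (z : R) : n%:R * z = \sum_(i < n) z.
    by rewrite sumr_const card_ord mulr_natl.
  apply: ler_sum => m _; rewrite expr2 -mulrA sumc; apply: ler_sum => i _.
  by rewrite sumc; apply: ler_sum => i' _; apply: class.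
rewrite [leLHS](_ : _ = A0.+1%:R ^+ 2 * (C `^ t * D `^ (1 - t) * T) *
    \sum_(m < M1) (m + 4)%:R ^+ 2 * expR (- (4 * l)) ^+ m); last first.
  by rewrite mulr_sumr; apply: eq_bigr => m _; rewrite /A natrM; ring.
apply: le_trans (ler_wpM2l _ (sumK M1)) _; first by rewrite !mulr_ge0 ?powR_ge0.
by rewrite -/T le_eqVlt; apply/orP; left; apply/eqP; ring.
Qed.

End bilinear.

(** * Rearrangements and Lorentz norms *)

Section dyadic_integrals.
Context {R : realType}.
Local Notation leb := (@lebesgue_measure R).

Definition dyadic_ioc (x : R) (j : nat) : set R := `]x * 2 ^+ j, x * 2 ^+ j.+1]%classic.

Lemma measurable_dyadic_ioc x j : measurable (dyadic_ioc x j).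
Proof. exact: measurable_itv. Qed.

Lemma dyadic_ioc_pos x j : 0 < x -> dyadic_ioc x j `<=` [set t | 0 < t].
Proof.
move=> x0 t; rewrite /dyadic_ioc/= in_itv/= => /andP[h _]; apply: lt_trans h.
by rewrite mulr_gt0// exprn_gt0.
Qed.

Lemma lebesgue_dyadic_ioc x j : 0 < x -> leb (dyadic_ioc x j) = (x * 2 ^+ j)%:E.
Proof.
move=> x0; rewrite lebesgue_measure_itv/= lte_fin ifT.
  by rewrite -EFinB; congr EFin; rewrite exprS; ring.
by rewrite ltr_pM2l// ltr_eXn2l ?ltr1n.
Qed.

Lemma measurable_pos : measurable [set t : R | 0 < t].
Proof.
have -> : [set t : R | 0 < t] = `]0, +oo[%classic by apply/seteqP; split => t /=; rewrite in_itv/= andbT.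
exact: measurable_itv.
Qed.

Lemma dyadic_integral_sum (G : R -> \bar R) (x : R) (N : nat) : 0 < x ->
  measurable_fun [set t : R | 0 < t] G -> (forall t : R, 0 < t -> (0 <= G t)%E) ->
  (\int[leb]_(t in `]x, (x * 2 ^+ N)%R]) G t =
   \sum_(j < N) \int[leb]_(t in dyadic_ioc x j) G t)%E.
Proof.
move=> x0 mG G0; elim: N => [|N IH].
  by rewrite big_ord0 expr0 mulr1 set_itv_ge ?bnd_simp ?ltxx// integral_set0.
have xN : x <= x * 2 ^+ N by rewrite ler_peMr ?(ltW x0)// exprn_ege1// ler1n.
have NN : x * 2 ^+ N <= x * 2 ^+ N.+1 by rewrite ler_pM2l// ler_eXn2l ?ltr1n.
rewrite big_ord_recr/= -IH -ge0_integral_setU//.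
- congr (integral _ _ _); rewrite /dyadic_ioc; apply/seteqP; split => t /=; rewrite !in_itv/=.
    move=> /andP[xt tN]; have [tN'|tN'] := leP t (x * 2 ^+ N); first by left; rewrite xt.
    by right.
  move=> [/andP[xt tN]|/andP[xt tN]]; first by rewrite xt (le_trans tN).
  by rewrite tN (le_lt_trans xN).
- exact: measurable_dyadic_ioc.
- apply: (measurable_funS measurable_pos _ mG) => t.
  move=> /= [|/(dyadic_ioc_pos x0)//]; rewrite in_itv/= => /andP[xt _].
  exact: lt_trans xt.
- move=> t [|/(dyadic_ioc_pos x0)/G0//] /=; rewrite in_itv/= => /andP[xt _].
  by apply: G0; apply: lt_trans xt.
- rewrite /dyadic_ioc; apply/disj_setPS => t [] /=; rewrite !in_itv/= => /andP[_ h] /andP[h' _].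
  by move: (lt_le_trans h' h); rewrite ltxx.
Qed.

(** The right endpoint is 2^N, written so that the interval splits into [N + N] dyadic pieces from
    the base point 2^(-N). *)
Lemma integral_pos_le (G : R -> \bar R) (W : \bar R) :
  measurable_fun [set t : R | 0 < t] G -> (forall t : R, 0 < t -> (0 <= G t)%E) ->
  (forall N : nat, \int[leb]_(t in `](2 ^- N)%R, (2 ^- N * 2 ^+ (N + N))%R]) G t <= W)%E ->
  (\int[leb]_(t in [set t : R | (0 < t)%R]) G t <= W)%E.
Proof.
move=> mG G0 h.
pose U (N : nat) : set R := `]2 ^- N, 2 ^- N * 2 ^+ (N + N)]%classic.
have UE N : U N = `]2 ^- N, 2 ^+ N]%classic.
  by rewrite /U exprD mulrA mulVf ?mul1r// expf_neq0.
have Upos N : U N `<=` [set t | 0 < t].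
  move=> t; rewrite UE/= in_itv/= => /andP[h1 _]; apply: lt_trans h1.
  by rewrite invr_gt0 exprn_gt0.
have -> : [set t : R | 0 < t] = \bigcup_N U N.
  apply/seteqP; split => [t /= t0|t [N _ /Upos]//].
  pose N := maxn (Num.truncn t^-1).+1 (Num.truncn t).+1.
  have up (z : R) (M : nat) : 0 <= z -> (Num.truncn z < M)%N -> z < 2 ^+ M.
    move=> z0 zM; apply: lt_le_trans (truncnS_gt _) _.
    by rewrite -natrX ler_nat (leq_trans zM)// ltnW// ltn_expl.
  exists N => //; rewrite UE/= in_itv/=; apply/andP; split.
    rewrite invf_plt ?posrE ?exprn_gt0//; apply: up; first by rewrite invr_ge0 ltW.
    exact: leq_maxl.
  by apply/ltW/up; [exact: ltW|exact: leq_maxr].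
have ndU : nondecreasing_seq U.
  move=> N M NM; apply/subsetPset => t; rewrite !UE/= !in_itv/= => /andP[a b].
  apply/andP; split.
    by apply: le_lt_trans a; rewrite lef_pV2 ?posrE ?exprn_gt0// ler_eXn2l ?ltr1n.
  by apply: le_trans b _; rewrite ler_eXn2l ?ltr1n.
have mU N : measurable (U N) by exact: measurable_itv.
have cv : (\int[leb]_(t in U i) G t @[i --> \oo] --> \int[leb]_(t in \bigcup_i U i) G t)%E.
  apply: ge0_nondecreasing_set_cvg_integral => //.
    by move=> N; apply: measurable_funS mG; [exact: measurable_pos|exact: Upos].
  by move=> N t /Upos; apply: G0.
rewrite -(cvg_lim _ cv)//; apply: lime_le; first by apply/cvg_ex; eexists; exact: cv.
by near=> N; apply: h.
Unshelve. all: by end_near. Qed.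

End dyadic_integrals.

Section rearrangement.
Context {R : realType} {n : nat} (mu : {measure set (n.-tuple R) -> \bar R}).
Variable f : n.-tuple R -> R.
Hypothesis mf : measurable_fun [set: n.-tuple R] f.

Lemma measurable_level y : measurable [set x | y < `|f x|].
Proof.
rewrite -[X in measurable X]setTI.
have -> : [set x | y < `|f x|] = (fun x => `|f x|) @^-1` `]y, +oo[%classic.
  by apply/seteqP; split => x /=; rewrite in_itv/= andbT.
exact: (measurableT_comp (@normr_measurable R setT) mf).
Qed.

Lemma distrib_le (y z : R) : y <= z -> (distrib mu f z <= distrib mu f y)%E.
Proof.
move=> yz; apply: le_measure; rewrite ?inE; [exact: measurable_level..|].
by move=> x /=; apply: le_lt_trans.
Qed.

Lemma rearr_ge0 t : (0 <= rearr mu f t)%E.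
Proof. by apply/ereal_infP => _ [s [s0 _] <-]; rewrite lee_fin. Qed.

(** From left to right this is the definition of the infimum. The converse uses continuity of the
    measure from below along the levels [y + 1 / (m + 1)], which places the rearrangement strictly
    above [y]. *)
Lemma rearr_gt (y t : R) : 0 <= y ->
  (y%:E < rearr mu f t)%E = (t%:E < distrib mu f y)%E.
Proof.
move=> y0; apply/idP/idP => [|tD].
  apply: contraTT; rewrite -!leNgt => Dt.
  by apply: ereal_inf_lbound; exists y.
pose U (m : nat) := [set x | y + m.+1%:R^-1 < `|f x|].
have mU m : measurable (U m) by exact: measurable_level.
have UE : \bigcup_m U m = [set x | y < `|f x|].
  apply/seteqP; split => [x [m _]|x /= yx].
    by apply: le_lt_trans; rewrite lerDl.
  have d0 : 0 < `|f x| - y by rewrite subr_gt0.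
  exists (Num.truncn (`|f x| - y)^-1) => //; rewrite /U/= -ltrBrDl.
  by rewrite invf_plt ?posrE// truncnS_gt.
have cv : mu \o U @ \oo --> mu (\bigcup_m U m).
  apply: nondecreasing_cvg_mu => //; first exact: bigcup_measurable.
  move=> a b ab; apply/subsetPset => x /=; apply: le_lt_trans.
  by rewrite lerD2l lef_pV2 ?posrE// ler_nat.
have [m tm] : exists m, (t%:E < mu (U m))%E.
  apply: contrapT => /forallNP h; move: tD; apply/negP; rewrite -leNgt /distrib -UE.
  rewrite -(cvg_lim _ cv)//; apply: lime_le; first by apply/cvg_ex; eexists; exact: cv.
  by near=> m; rewrite leNgt; apply/negP/h.
apply: (@lt_le_trans _ _ (y + m.+1%:R^-1)%:E); first by rewrite lte_fin ltrDl.
apply/ereal_infP => _ [s [s0 sD] <-]; rewrite lee_fin leNgt; apply/negP => sy.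
have := le_lt_trans sD tm; rewrite ltNge => /negP; apply.
by apply: distrib_le; apply: ltW.
Unshelve. all: by end_near. Qed.

Lemma rearr_anti (t t' : R) : t <= t' -> (rearr mu f t' <= rearr mu f t)%E.
Proof.
move=> tt'; apply/ereal_infP => _ [s [s0 sD] <-]; apply: ereal_inf_lbound.
by exists s => //; split => //; apply: le_trans sD _; rewrite lee_fin.
Qed.

Lemma measurable_rearr : measurable_fun [set: R] (rearr mu f).
Proof.
apply: (measurability _ (ErealGenOInfty.measurableE R)) => //.
move=> /= _ [_ [y ->]] <-; apply: measurableI => //.
apply: is_interval_measurable => a b /= _ + c /andP[_ cb].
rewrite !in_itv/= !andbT => yb; apply: lt_le_trans yb _; exact: rearr_anti.
Qed.

End rearrangement.

Section lorentz.
Context {R : realType} {n : nat} (mu : {measure set (n.-tuple R) -> \bar R}).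
Local Notation leb := (@lebesgue_measure R).
Variables (f : n.-tuple R -> R) (p q : R).
Hypotheses (p0 : 0 < p) (q0 : 0 < q).

Definition lorentz_term (t : R) : \bar R :=
  (((t `^ p^-1)%:E * rearr mu f t) `^ q)%E.

Local Notation G := (fun t : R => lorentz_term t * (t^-1)%:E)%E.

Lemma lorentz_term_ge0 t : (0 <= lorentz_term t)%E.
Proof. exact: poweR_ge0. Qed.

Lemma lorentz_integrand_ge0 (t : R) : 0 < t -> (0 <= G t)%E.
Proof. by move=> t0; rewrite mule_ge0 ?lorentz_term_ge0// lee_fin invr_ge0 ltW. Qed.

Lemma measurable_lorentz_integrand : measurable_fun [set t : R | 0 < t] G.
Proof.
apply: emeasurable_funM.
  apply: (measurableT_comp (@measurable_poweR R q)).
  apply: emeasurable_funM.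
    by apply/measurable_EFinP; apply: measurable_funTS; exact: measurable_powR.
  by apply: measurable_funTS; exact: measurable_rearr.
apply/measurable_EFinP.
apply: (eq_measurable_fun (fun t : R => t `^ (-1))).
  by move=> t; rewrite inE/= => t0; rewrite powR_inv1// ltW.
by apply: measurable_funTS; exact: measurable_powR.
Qed.

(** The term at [t0] is compared with the integral over (t0/2, t0], where the rearrangement is at
    least its value at [t0]; hence the base point [x / 2]. The constant pays 2^(q/p) for t^(1/p) and
    2 for the length [t0 / 2]. *)
Lemma lorentz_term_sum_le (x : R) (N : nat) : 0 < x ->
  (\sum_(j < N) lorentz_term (x * 2 ^+ j) <= (2 `^ (q / p) * 2)%:E *
     \int[leb]_(t in [set t : R | (0 < t)%R]) G t)%E.
Proof.
move=> x0; have x20 : 0 < x / 2 by rewrite divr_gt0.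
apply: (@le_trans _ _ ((2 `^ (q / p) * 2)%:E *
    \int[leb]_(t in `](x / 2)%R, (x / 2 * 2 ^+ N)%R]) G t)%E); last first.
  rewrite lee_wpmul2l ?lee_fin ?mulr_ge0 ?powR_ge0//.
  apply: ge0_subset_integral => //; [exact: measurable_pos|
    exact: measurable_lorentz_integrand|exact: lorentz_integrand_ge0|].
  by move=> t /=; rewrite in_itv/= => /andP[h _]; apply: lt_trans h.
rewrite dyadic_integral_sum//; last 2 first.
- exact: measurable_lorentz_integrand.
- exact: lorentz_integrand_ge0.
rewrite ge0_sume_distrr//; last first.
  move=> j _; apply: integral_ge0 => t /(dyadic_ioc_pos x20); exact: lorentz_integrand_ge0.
apply: lee_sum => j _; set t0 := x * 2 ^+ j.
have t00 : 0 < t0 by rewrite mulr_gt0// exprn_gt0.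
have t0E : x / 2 * 2 ^+ j.+1 = t0 by rewrite exprS /t0; field.
have t0E' : x / 2 * 2 ^+ j = t0 / 2 by rewrite /t0; field.
set c := ((((t0 / 2) `^ p^-1)%:E * rearr mu f t0) `^ q * (t0^-1)%:E)%E.
have c0 : (0 <= c)%E by rewrite mule_ge0 ?poweR_ge0// lee_fin invr_ge0 ltW.
have -> : lorentz_term t0 = ((2 `^ (q / p) * 2)%:E * (c * (t0 / 2)%:E))%E.
  rewrite /c -muleA -EFinM muleCA -EFinM /lorentz_term.
  rewrite [RHS](_ : _ = (2 `^ (q / p))%:E *
     (((t0 / 2) `^ p^-1)%:E * rearr mu f t0) `^ q)%E; last first.
    rewrite muleC; congr (_%:E * _)%E; field; by rewrite gt_eqF.
  rewrite !poweRM ?lee_fin ?powR_ge0 ?rearr_ge0// muleA; congr (_ * _)%E.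
  rewrite !poweR_EFin -EFinM -!powRrM; congr EFin.
  by rewrite (mulrC q) -powRM ?divr_ge0 ?(ltW t00)//; congr (_ `^ _); field.
rewrite lee_wpmul2l ?lee_fin ?mulr_ge0 ?powR_ge0//.
rewrite -t0E' -(lebesgue_dyadic_ioc j x20) -integral_cst; last exact: measurable_dyadic_ioc.
apply: ge0_le_integral => //; first exact: measurable_dyadic_ioc.
  apply: measurable_funS measurable_lorentz_integrand; first exact: measurable_pos.
  exact: dyadic_ioc_pos.
move=> t; rewrite /dyadic_ioc/= in_itv/= t0E t0E' => /andP[t1 t2].
have t20 : 0 < t0 / 2 by rewrite divr_gt0.
have tp : 0 < t by apply: lt_trans t1.
apply: lee_pmul; rewrite ?poweR_ge0 ?lee_fin ?invr_ge0 ?(ltW t00)//; last by rewrite lef_pV2.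
apply: gt0_ler_poweR; rewrite ?(ltW q0)// ?in_itv/= ?leey ?andbT ?mule_ge0 ?lee_fin ?powR_ge0 ?rearr_ge0//.
apply: lee_pmul; rewrite ?lee_fin ?powR_ge0 ?rearr_ge0//; last exact: rearr_anti.
by apply: ge0_ler_powR; rewrite ?nnegrE ?invr_ge0 ?(ltW p0) ?(ltW tp) ?(ltW t20) ?(ltW t1).
Qed.

(** Now the interval (t0, 2 t0] lies to the right of [t0], and the rearrangement is at most its
    value there. Length and weight 1/t cancel, leaving 2^(q/p). *)
Lemma lorentz_integral_le (W : \bar R) :
  (forall N : nat, \sum_(j < N + N) lorentz_term (2 ^- N * 2 ^+ j)%R <= W)%E ->
  (\int[leb]_(t in [set t : R | (0 < t)%R]) G t <= (2 `^ (q / p))%:E * W)%E.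
Proof.
move=> hW; apply: integral_pos_le; [exact: measurable_lorentz_integrand|
  exact: lorentz_integrand_ge0|move=> N].
have x0 : 0 < 2 ^- N :> R by rewrite invr_gt0 exprn_gt0.
rewrite dyadic_integral_sum//; last 2 first.
- exact: measurable_lorentz_integrand.
- exact: lorentz_integrand_ge0.
apply: le_trans (lee_wpmul2l _ (hW N)); last by rewrite lee_fin powR_ge0.
rewrite ge0_sume_distrr => [|j _]; last exact: lorentz_term_ge0.
apply: lee_sum => j _; set t0 := 2 ^- N * 2 ^+ j.
have t00 : 0 < t0 by rewrite mulr_gt0// exprn_gt0.
have t0E : 2 ^- N * 2 ^+ j.+1 = 2 * t0 by rewrite exprS /t0; ring.
set c := ((((2 * t0) `^ p^-1)%:E * rearr mu f t0) `^ q * (t0^-1)%:E)%E.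
have c0 : (0 <= c)%E by rewrite mule_ge0 ?poweR_ge0// lee_fin invr_ge0 ltW.
have -> : ((2 `^ (q / p))%:E * lorentz_term t0 = c * t0%:E)%E.
  rewrite /c -muleA -EFinM mulVf ?gt_eqF// mule1 /lorentz_term.
  rewrite !poweRM ?lee_fin ?powR_ge0 ?rearr_ge0// muleA; congr (_ * _)%E.
  rewrite !poweR_EFin -EFinM -!powRrM; congr EFin.
  by rewrite (mulrC q) -powRM// ltW.
rewrite -(lebesgue_dyadic_ioc j x0) -integral_cst; last exact: measurable_dyadic_ioc.
apply: ge0_le_integral => //; first exact: measurable_dyadic_ioc.
- by move=> t /(dyadic_ioc_pos x0); exact: lorentz_integrand_ge0.
- apply: measurable_funS measurable_lorentz_integrand; first exact: measurable_pos.
  exact: dyadic_ioc_pos.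
move=> t; rewrite /dyadic_ioc/= in_itv/= t0E -/t0 => /andP[t1 t2].
have tp : 0 < t by apply: lt_trans t1.
apply: lee_pmul; rewrite ?poweR_ge0 ?lee_fin ?invr_ge0 ?(ltW tp)//; last by rewrite lef_pV2 ?posrE// ltW.
apply: gt0_ler_poweR; rewrite ?(ltW q0)// ?in_itv/= ?leey ?andbT ?mule_ge0 ?lee_fin ?powR_ge0 ?rearr_ge0//.
apply: lee_pmul; rewrite ?lee_fin ?powR_ge0 ?rearr_ge0//; last by apply: rearr_anti; exact: ltW.
by apply: ge0_ler_powR; rewrite ?nnegrE ?invr_ge0 ?(ltW p0) ?(ltW tp)// mulr_ge0// ltW.
Qed.

Lemma lorentz_normE : lorentz_norm mu p q f =
  ((\int[leb]_(t in [set t : R | (0 < t)%R]) G t) `^ q^-1)%E.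
Proof. by []. Qed.

End lorentz.

Section real_lemmas.
Context {R : realType}.

(** The embedding of l^u in l^u': no single term exceeds [W]. It serves once to pass from [u] to 1/p
    and once from 1/p to [v]. *)
Lemma sum_powR_le (u u' W : R) (N : nat) (z : nat -> R) : 0 < u -> u <= u' ->
  (forall j, 0 <= z j) -> \sum_(j < N) z j `^ u <= W ->
  \sum_(j < N) z j `^ u' <= W `^ (u' / u).
Proof.
move=> u0 uu' z0 zW; have u'0 : 0 < u' by apply: lt_le_trans uu'.
have W0 : 0 <= W by apply: le_trans zW; rewrite sumr_ge0// => j _; rewrite powR_ge0.
have uu : 0 < u' / u by rewrite divr_gt0.
apply: (@le_trans _ _ (\sum_(j < N) z j `^ u * W `^ (u' / u - 1))).
  apply: ler_sum => j _.
  have -> : z j `^ u' = z j `^ u * (z j `^ u) `^ (u' / u - 1).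
    by rewrite mulr_powRB1 ?powR_ge0// -powRrM mulrC divfK// gt_eqF.
  rewrite ler_wpM2l ?powR_ge0//; apply: ge0_ler_powR; rewrite ?nnegrE ?powR_ge0//.
    by rewrite subr_ge0 ler_pdivlMr// mul1r.
  apply: le_trans zW; apply: (ler_sum_term (f := fun i : 'I_N => z i `^ u)) => i.
  by rewrite powR_ge0.
rewrite -mulr_suml -(mulr_powRB1 W0 uu) ler_wpM2r ?powR_ge0//.
Qed.

(* Testing the bilinear bound on [y = tau z^(1/p - 1)] with a small [tau]. *)
Lemma sum_powR_of_dual (K p : R) : 0 < K -> 0 < p < 1 -> exists2 K', 0 < K' &
  forall (N : nat) (z : nat -> R) (A : R), (forall k, 0 <= z k) ->
  (forall y : nat -> R, (forall k, 0 <= y k) ->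
     \sum_(k < N) y k * z k <= K * (A + \sum_(k < N) y k `^ (1 - p)^-1)) ->
  \sum_(k < N) z k `^ p^-1 <= K' * A.
Proof.
move=> K0 /andP[p0 p1]; have q0 : 0 < 1 - p by rewrite subr_gt0.
have K20 : 0 < (2 * K)^-1 by rewrite invr_gt0 mulr_gt0.
(* At this value the dual term equals half of the left-hand side and can be absorbed. *)
pose tau := (2 * K)^-1 `^ ((1 - p) / p).
have tau0 : 0 < tau by rewrite powR_gt0.
have tauE : K * tau `^ (1 - p)^-1 = tau / 2.
  have -> : tau `^ (1 - p)^-1 = tau * (2 * K)^-1.
    rewrite /tau -powRrM -{3}(powRr1 (ltW K20)) -powRD; last by rewrite (gt_eqF K20) implybT.
    by congr (_ `^ _); field; rewrite !gt_eqF.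
  by field; rewrite gt_eqF.
exists (2 * K / tau); first by rewrite divr_gt0// mulr_gt0.
move=> N z A z0 h.
have := h (fun k => tau * z k `^ (p^-1 - 1)) _.
have -> : \sum_(k < N) tau * z k `^ (p^-1 - 1) * z k = tau * \sum_(k < N) z k `^ p^-1.
  rewrite mulr_sumr; apply: eq_bigr => k _.
  by rewrite -mulrA; congr (_ * _); rewrite mulrC mulr_powRB1// invr_gt0.
have -> : \sum_(k < N) (tau * z k `^ (p^-1 - 1)) `^ (1 - p)^-1
    = tau `^ (1 - p)^-1 * \sum_(k < N) z k `^ p^-1.
  rewrite mulr_sumr; apply: eq_bigr => k _.
  rewrite powRM ?powR_ge0 ?(ltW tau0)// -powRrM; congr (_ * _ `^ _).
  by field; rewrite !gt_eqF.
move=> /(_ _)/le_trans H.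
set Z := \sum_(k < N) z k `^ p^-1 in H *.
have {}H : tau * Z <= K * A + tau / 2 * Z.
  rewrite -tauE -mulrA -mulrDr; apply: (H _ _ (lexx _)) => k.
  by rewrite mulr_ge0 ?powR_ge0// ltW.
rewrite -(ler_pM2l tau0) (_ : tau * (2 * K / tau * A) = 2 * (K * A)); first lra.
by field; rewrite gt_eqF.
Qed.

End real_lemmas.

Section level_sets.
Context {R : realType} {n : nat} (mu : {measure set (n.-tuple R) -> \bar R}).
Variables (f : n.-tuple R -> R).
Hypothesis mf : measurable_fun [set: n.-tuple R] f.
Local Notation a t := (fine (rearr mu f t)).

(** Since [fine] sends +oo to 0, this is the intended set of measure at most [t] only where the
    rearrangement is finite. *)
Definition super_level (t : R) := [set x | fine (rearr mu f t) < `|f x|].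

Lemma measurable_super_level t : measurable (super_level t).
Proof. exact: measurable_level. Qed.

Section finite_rearrangement.
Hypothesis fin : forall t : R, 0 < t -> rearr mu f t \is a fin_num.

Lemma super_level_measure t : 0 < t -> (mu (super_level t) <= t%:E)%E.
Proof.
move=> t0; rewrite leNgt -rearr_gt//; last by rewrite fine_ge0// rearr_ge0.
by rewrite fineK ?fin// ltxx.
Qed.

Lemma super_level_mono (t t' : R) : 0 < t -> t <= t' -> super_level t `<=` super_level t'.
Proof.
move=> t0 tt' x /=; apply: le_lt_trans; apply: fine_le; rewrite ?fin ?(lt_le_trans t0)//.
exact: rearr_anti.
Qed.

Lemma le_abs_of_not_super_level t x : ~ super_level t x -> `|f x| <= a t.
Proof. by move=> h; rewrite leNgt; apply/negP. Qed.

(** On the shell between the parameters [x0 * 2 ^+ j] and [x0 * 2 ^+ j.+1] the function is at most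
    the rearrangement at the smaller one. Hence the value at [j] goes with the set at [j.+1]. *)
Lemma integral_level_le (g : n.-tuple R -> \bar R) (x0 : R) (m : nat) : 0 < x0 ->
  measurable_fun [set: n.-tuple R] g -> (forall x, 0 <= g x)%E ->
  (\int[mu]_(x in super_level (x0 * 2 ^+ m) `\` super_level x0) (`|f x|%:E * g x) <=
   \sum_(j < m) (a (x0 * 2 ^+ j))%:E * \int[mu]_(x in super_level (x0 * 2 ^+ j.+1)) g x)%E.
Proof.
move=> x00 mg g0.
have mfg : measurable_fun [set: n.-tuple R] (fun x => `|f x|%:E * g x)%E.
  apply: emeasurable_funM => //; apply/measurable_EFinP.
  exact: (measurableT_comp (@normr_measurable R setT) mf).
have fg0 x : (0 <= `|f x|%:E * g x)%E by rewrite mule_ge0 ?lee_fin.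
have t0 j : 0 < x0 * 2 ^+ j by rewrite mulr_gt0// exprn_gt0.
have tle j k : (j <= k)%N -> x0 * 2 ^+ j <= x0 * 2 ^+ k.
  by move=> jk; rewrite ler_pM2l// ler_eXn2l ?ltr1n.
elim: m => [|m IH].
  by rewrite big_ord0 expr0 mulr1 setDv integral_set0.
rewrite big_ord_recr/=.
have -> : super_level (x0 * 2 ^+ m.+1) `\` super_level x0 =
    (super_level (x0 * 2 ^+ m) `\` super_level x0) `|`
    (super_level (x0 * 2 ^+ m.+1) `\` super_level (x0 * 2 ^+ m)).
  apply/seteqP; split => x.
    by move=> [h1 h2]; have [h|h] := pselect (super_level (x0 * 2 ^+ m) x); [left|right].
  move=> [[h1 h2]|[h1 h2]]; split => //.
    by apply: super_level_mono h1 => //; exact: tle.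
  move=> h; apply: h2; apply: super_level_mono h => //.
  by rewrite -[leLHS]mulr1 -(expr0 2) tle.
rewrite ge0_integral_setU//; last 4 first.
- by apply: measurableD; exact: measurable_super_level.
- by apply: measurableD; exact: measurable_super_level.
- exact: measurable_funTS.
- by apply/disj_setPS => x [[h _] [_]].
apply: leeD IH _.
have a0 : (0 <= (a (x0 * 2 ^+ m))%:E)%E by rewrite lee_fin fine_ge0// rearr_ge0.
rewrite -ge0_integralZl//; last exact: measurable_funTS; last exact: measurable_super_level.
apply: (@le_trans _ _ (\int[mu]_(x in super_level (x0 * 2 ^+ m.+1) `\` super_level (x0 * 2 ^+ m))
    ((a (x0 * 2 ^+ m))%:E * g x))%E).
  apply: ge0_le_integral => //.
  - by apply: measurableD; exact: measurable_super_level.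
  - exact: measurable_funTS.
  - by apply: measurable_funTS; apply: emeasurable_funM.
  - move=> x [_ /le_abs_of_not_super_level h].
    by rewrite lee_wpmul2r// lee_fin.
apply: ge0_subset_integral => //.
- by apply: measurableD; exact: measurable_super_level.
- exact: measurable_super_level.
- by apply: measurable_funTS; apply: emeasurable_funM.
- by move=> x _; rewrite mule_ge0.
Qed.

(** The shells between 2^(-m) and 2^m exhaust the support of [f] up to the null set [Z]. *)
Lemma integral_abs_le (g : n.-tuple R -> \bar R) (B : \bar R) (al u W : R) : 0 < u -> 0 <= al ->
  (forall N : nat, \sum_(j < N) (a (1 * 2 ^+ j) * (1 * 2 ^+ j) `^ al) `^ u <= W) ->
  measurable_fun [set: n.-tuple R] g -> (forall x, 0 <= g x)%E ->
  (forall m : nat, \sum_(j < m + m) (a (2 ^- m * 2 ^+ j))%:E *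
     \int[mu]_(x in super_level (2 ^- m * 2 ^+ j.+1)) g x <= B)%E ->
  (\int[mu]_x (`|f x|%:E * g x) <= B)%E.
Proof.
move=> u0 al0 hW mg g0 hB.
have mfg : measurable_fun [set: n.-tuple R] (fun x => `|f x|%:E * g x)%E.
  apply: emeasurable_funM => //; apply/measurable_EFinP.
  exact: (measurableT_comp (@normr_measurable R setT) mf).
have fg0 x : (0 <= `|f x|%:E * g x)%E by rewrite mule_ge0 ?lee_fin.
have i2 m : 0 < 2 ^- m :> R by rewrite invr_gt0 exprn_gt0.
have s2 m : 0 < 2 ^+ m :> R by rewrite exprn_gt0.
have ile m k : (m <= k)%N -> 2 ^- k <= 2 ^- m :> R.
  by move=> mk; rewrite lef_pV2 ?posrE// ler_eXn2l ?ltr1n.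
have sle m k : (m <= k)%N -> 2 ^+ m <= 2 ^+ k :> R.
  by move=> mk; rewrite ler_eXn2l ?ltr1n.
pose Z := \bigcap_m super_level (2 ^- m).
have mZ : measurable Z by apply: bigcapT_measurable => m; exact: measurable_super_level.
have Z0 : mu Z = 0%E.
  apply/eqP; rewrite eq_le measure_ge0 andbT; apply/lee_addgt0Pr => e e0; rewrite add0e.
  apply: (@le_trans _ _ (2 ^- (Num.truncn e^-1))%:E); last first.
    rewrite lee_fin invf_ple ?posrE//; apply: ltW; apply: lt_le_trans (truncnS_gt _) _.
    by rewrite -natrX ler_nat ltn_expl.
  apply: le_trans (super_level_measure (i2 _)); apply: le_measure; rewrite ?inE//.
    exact: measurable_super_level.
  by move=> x; apply.
pose D m := super_level (2 ^+ m) `\` super_level (2 ^- m).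
have mD m : measurable (D m) by apply: measurableD; exact: measurable_super_level.
have mUD : measurable (\bigcup_m D m) by exact: bigcupT_measurable.
(* A nonzero value below the rearrangement at every 2^j would make the sums in [hW] grow linearly in
   [N]. *)
have small x : f x != 0 -> exists m, super_level (2 ^+ m) x.
  move=> fx; apply: contrapT => /forallNP h.
  have fx0 : 0 < `|f x| `^ u by rewrite powR_gt0// normr_gt0.
  have := hW (Num.truncn (W / `|f x| `^ u)).+1; apply/negP; rewrite -ltNge.
  apply: (@lt_le_trans _ _ (\sum_(j < (Num.truncn (W / `|f x| `^ u)).+1) `|f x| `^ u)).
    by rewrite sumr_const card_ord -mulr_natl -ltr_pdivrMr// truncnS_gt.
  apply: ler_sum => j _; apply: ge0_ler_powR; rewrite ?nnegrE ?(ltW u0)//.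
    by rewrite mulr_ge0 ?powR_ge0// fine_ge0// rearr_ge0.
  rewrite mul1r; apply: le_trans (le_abs_of_not_super_level (h j)) _.
  rewrite ler_peMr ?fine_ge0 ?rearr_ge0//; apply: le_trans (_ : (2 ^+ j) `^ 0 <= _).
    by rewrite powRr0.
  by apply: ler_powR => //; rewrite exprn_ege1// ler1n.
rewrite (ge0_negligible_integral mZ measurableT mfg _ Z0)//.
have -> : [set: n.-tuple R] `\` Z = (\bigcup_m D m) `|` (~` Z `\` \bigcup_m D m).
  apply/seteqP; split => x.
    by move=> [_ nZ]; have [h|h] := pselect ((\bigcup_m D m) x); [left|right].
  move=> [[m _ [_ h]]|[]//]; split => // Zx; exact/h/Zx.
rewrite ge0_integral_setU//; last 3 first.
- by apply: measurableD => //; apply: measurableC.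
- exact: measurable_funTS.
- by apply/disj_setPS => x [h [_]].
rewrite [X in (_ + X)%E](_ : _ = 0%E) ?adde0; last first.
  rewrite -[RHS](integral0 mu (~` Z `\` \bigcup_m D m)); apply: eq_integral => x.
  rewrite inE => -[nZ nD]; suff -> : f x = 0 by rewrite normr0 mul0e.
  apply/eqP; apply: contrapT => /negP/small[m hm]; apply: nZ => k _.
  pose M := maxn m k.
  have h1 : super_level (2 ^+ M) x by apply: super_level_mono hm => //; exact/sle/leq_maxl.
  have : ~ D M x by move=> h; apply: nD; exists M.
  move=> /not_andP[//|/contrapT]; apply: super_level_mono => //.
  exact/ile/leq_maxr.
have ndD : nondecreasing_seq D.
  move=> m k mk; apply/subsetPset => x [h1 h2]; split.
    by apply: super_level_mono h1 => //; exact: sle.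
  by move=> h; apply: h2; apply: super_level_mono h => //; exact: ile.
have cv : (\int[mu]_(x in D m) (`|f x|%:E * g x) @[m --> \oo]
    --> \int[mu]_(x in \bigcup_m D m) (`|f x|%:E * g x))%E.
  apply: ge0_nondecreasing_set_cvg_integral => // m.
  exact: measurable_funTS.
rewrite -(cvg_lim _ cv)//; apply: lime_le; first by apply/cvg_ex; eexists; exact: cv.
near=> m; apply: le_trans (hB m).
have mm : 2 ^- m * 2 ^+ (m + m) = 2 ^+ m :> R.
  by rewrite exprD mulrA mulVf ?mul1r// expf_neq0.
have I := integral_level_le (m + m) (i2 m) mg g0; rewrite mm in I; exact: I.
Unshelve. all: by end_near. Qed.

End finite_rearrangement.
End level_sets.

(** * From the bilinear bound to Lorentz norms *)

Section lorentz_operator.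
Context {R : realType} {n : nat} (mu : {measure set (n.-tuple R) -> \bar R}).
Local Notation X := (n.-tuple R).
Local Notation leb := (@lebesgue_measure R).

Definition lorentz_integral (p q : R) (f : X -> R) : \bar R :=
  (\int[leb]_(t in [set t : R | (0 < t)%R]) (lorentz_term mu f p q t * (t^-1)%:E))%E.

Lemma lorentz_integral_ge0 p q f : (0 <= lorentz_integral p q f)%E.
Proof. by apply: integral_ge0 => t; exact: lorentz_integrand_ge0. Qed.

Lemma lorentz_term_fine (f : X -> R) (p q t : R) : rearr mu f t \is a fin_num ->
  lorentz_term mu f p q t = ((fine (rearr mu f t) * t `^ p^-1) `^ q)%:E.
Proof. by move=> h; rewrite /lorentz_term -{1}(fineK h) -EFinM poweR_EFin mulrC. Qed.

Lemma lorentz_rearr_fin (f : X -> R) (p q t W : R) :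
  0 < p -> 0 < q -> 0 < t ->
  (lorentz_integral p q f <= W%:E)%E -> rearr mu f t \is a fin_num.
Proof.
move=> p0 q0 t0 fW; rewrite ge0_fin_numE ?rearr_ge0//.
have := lorentz_term_sum_le mu f p0 q0 1 t0.
rewrite big_ord1 expr0 mulr1 => h.
have : (lorentz_term mu f p q t < +oo)%E.
  apply: le_lt_trans h _; apply: le_lt_trans (lee_wpmul2l _ fW) _.
    by rewrite lee_fin mulr_ge0// powR_ge0.
  by rewrite -EFinM ltry.
move=> /(lty_poweRy (lt0r_neq0 q0)); rewrite ltNge leye_eq => /negP fo.
rewrite ltNge leye_eq; apply/negP => /eqP fE; apply: fo.
by rewrite fE gt0_muley// lte_fin powR_gt0.
Qed.

Lemma lorentz_dyadic_sum_le (f : X -> R) (p q x W : R) (N : nat) :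
  0 < p -> 0 < q -> 0 < x ->
  (lorentz_integral p q f <= W%:E)%E ->
  \sum_(j < N) (fine (rearr mu f (x * 2 ^+ j)) * (x * 2 ^+ j) `^ p^-1) `^ q
    <= 2 `^ (q / p) * 2 * W.
Proof.
move=> p0 q0 x0 fW.
rewrite -lee_fin -sumEFin (eq_bigr (fun j : 'I_N => lorentz_term mu f p q (x * 2 ^+ j))).
  apply: le_trans (lorentz_term_sum_le mu f p0 q0 N x0) _.
  by rewrite (EFinM _ W) lee_wpmul2l// lee_fin mulr_ge0// powR_ge0.
move=> j _; rewrite lorentz_term_fine//.
by apply: lorentz_rearr_fin fW => //; rewrite mulr_gt0// exprn_gt0.
Qed.

Variables (S S' : set X -> X -> \bar R) (r s u v p : R).
Hypotheses (S0 : nonneg_measurable S) (S'0 : nonneg_measurable S').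
Hypothesis SS' : adjoint mu S S'.
Hypotheses (r1 : 1 < r) (s0 : 0 < s) (u0 : 0 < u) (sp : s^-1 < p) (pr : p < r^-1).
Hypotheses (up : u <= p^-1) (pv : p^-1 <= v).
Hypothesis est : two_set_estimate mu S r^-1 (1 - s^-1).
Hypothesis est' : two_set_estimate mu S' (1 - s^-1) r^-1.
Hypothesis divisible : forall (A : set X) (c : R), measurable A -> 0 < c -> (c%:E < mu A)%E ->
  exists F, [/\ measurable F, F `<=` A, ((c / 2)%:E <= mu F)%E & (mu F <= c%:E)%E].

Let be := 1 - s^-1.

Lemma dual_bound : exists2 K : R, 0 < K &
  forall (f : X -> R) (W : R) (F : nat -> set X) (y0 : R) (N : nat) (b : nat -> R),
  measurable_fun [set: X] f -> 0 <= W -> (lorentz_integral r u f <= W%:E)%E ->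
  0 < y0 -> (forall k, measurable (F k)) -> (forall k, mu (F k) <= (y0 * 2 ^+ k)%:E)%E ->
  (forall k, 0 <= b k) ->
  (\sum_(k < N) (b k)%:E * \int[mu]_x (`|f x|%:E * S' (F k) x) <=
   (K * (W `^ (p * u)^-1 + \sum_(k < N) (b k * (y0 * 2 ^+ k) `^ be) `^ (1 - p)^-1))%:E)%E.
Proof.
have r0 : 0 < r by apply: lt_trans r1.
have ri0 : 0 < r^-1 by rewrite invr_gt0.
have p0 : 0 < p by apply: lt_trans sp; rewrite invr_gt0.
have ri1 : r^-1 < 1 by rewrite invf_lt1.
have be1 : be < 1 by rewrite gtrBl invr_gt0.
have pbe : 1 - be < p by rewrite subKr.
have [K K0 hK] := bilinear_estimate S0 S'0 SS' ri1 be1 pbe pr est est'.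
(* The first factor comes from replacing [x0] by [2 * x0] in the sizes, the second from the dyadic
   sum against the Lorentz integral. As [W] is the power u of the norm, [W ^ (p u)^-1] is the power
   1/p of it. *)
pose c := (2 `^ r^-1) `^ p^-1 * (2 `^ (u / r) * 2) `^ (p * u)^-1.
have c0 : 0 < c by rewrite mulr_gt0 ?powR_gt0// mulr_gt0 ?powR_gt0.
exists (K * (c + 1)); first by rewrite mulr_gt0// addr_gt0.
move=> f W F y0 N b mf W0 fW y00 mF Fy b0.
have fin t : 0 < t -> rearr mu f t \is a fin_num.
  by move=> t0; apply: lorentz_rearr_fin fW.
(* Merging the tested sets into one weight allows a single decomposition of [f] for all [k]. *)
pose g x := (\sum_(k < N) (b k)%:E * S' (F k) x)%E.
have g0 x : (0 <= g x)%E.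
  by apply: sume_ge0 => k _; rewrite mule_ge0 ?lee_fin//; apply: (S'0 (mF k)).2.
have mS' k : measurable_fun [set: X] (S' (F k)) by exact: (S'0 (mF k)).1.
have mg : measurable_fun [set: X] g.
  by apply: emeasurable_sum => k; apply: measurable_funeM.
have mfS k : measurable_fun [set: X] (fun x => `|f x|%:E * S' (F k) x)%E.
  apply: emeasurable_funM => //; apply/measurable_EFinP.
  exact: (measurableT_comp (@normr_measurable R setT) mf).
have S'ge k x : (0 <= S' (F k) x)%E by apply: (S'0 (mF k)).2.
have fS0 k x : (0 <= `|f x|%:E * S' (F k) x)%E by rewrite mule_ge0 ?lee_fin.
have -> : (\sum_(k < N) (b k)%:E * \int[mu]_x (`|f x|%:E * S' (F k) x) =
    \int[mu]_x (`|f x|%:E * g x))%E.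
  under eq_bigr do rewrite -ge0_integralZl ?lee_fin//.
  rewrite -ge0_integral_sum//; last first.
  - by move=> k x _; rewrite mule_ge0 ?lee_fin.
  - by move=> k; apply: measurable_funeM.
  apply: eq_integral => x _; rewrite /g ge0_sume_distrr.
    by apply: eq_bigr => k _; rewrite muleCA.
  by move=> k _; rewrite mule_ge0 ?lee_fin.
apply: (integral_abs_le mf fin u0 (ltW ri0) (W := 2 `^ (u / r) * 2 * W)) => //.
  by move=> M; apply: lorentz_dyadic_sum_le fW.
move=> m.
set x0 : R := 2 ^- m.
have x00 : 0 < x0 by rewrite invr_gt0 exprn_gt0.
have x20 : 0 < 2 * x0 by rewrite mulr_gt0.
pose a j := fine (rearr mu f (x0 * 2 ^+ j)).
have a0 j : 0 <= a j by rewrite fine_ge0// rearr_ge0.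
(* By the shift in [integral_level_le] the set has measure at most [2 * x0 * 2 ^+ j], so the
   bilinear estimate is used with base [2 * x0]. *)
pose E j := super_level mu f (x0 * 2 ^+ j.+1).
have mE j : measurable (E j) by exact: measurable_super_level.
have Ex j : (mu (E j) <= (2 * x0 * 2 ^+ j)%:E)%E.
  rewrite -mulrA mulrCA -exprS; apply: super_level_measure => //.
  by rewrite mulr_gt0// exprn_gt0.
have := hK E F (2 * x0) y0 (m + m)%N N a b x20 y00 mE mF Ex Fy a0 b0.
set lhs := (X in (X <= _)%E -> _); set rhs := (X in (_ <= X)%E -> _).
move=> h; apply: (@le_trans _ _ lhs).
  rewrite le_eqVlt; apply/orP; left; apply/eqP; apply: eq_bigr => j _.
  rewrite -/(a j) -/(E j).
  have -> : (\int[mu]_(x in E j) g x = \sum_(k < N) (b k)%:E * \int[mu]_(t in F k) S (E j) t)%E.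
    rewrite /g ge0_integral_sum//; last first.
    - by move=> k x _; rewrite mule_ge0 ?lee_fin.
    - by move=> k; apply: measurable_funTS; apply: measurable_funeM.
    apply: eq_bigr => k _; rewrite ge0_integralZl ?lee_fin//; last exact: measurable_funTS.
    by rewrite SS'.
  rewrite ge0_sume_distrr; last first.
    by move=> k _; rewrite mule_ge0 ?lee_fin//; apply: integral_ge0 => x _; apply: (S0 (mE j)).2.
  by apply: eq_bigr => k _; rewrite muleA.
apply: le_trans h _; rewrite /rhs lee_fin -mulrA ler_wpM2l ?(ltW K0)//.
set B := \sum_(k < N) _.
have B0 : 0 <= B by rewrite sumr_ge0// => k _; rewrite powR_ge0.
have Wp0 : 0 <= W `^ (p * u)^-1 by rewrite powR_ge0.
apply: (@le_trans _ _ (c * W `^ (p * u)^-1 + B)); last first.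
  by have := mulr_ge0 (ltW c0) B0; lra.
rewrite lerD2r.
have -> : \sum_(j < m + m) (a j * (2 * x0 * 2 ^+ j) `^ r^-1) `^ p^-1 =
    (2 `^ r^-1) `^ p^-1 * \sum_(j < m + m) (a j * (x0 * 2 ^+ j) `^ r^-1) `^ p^-1.
  rewrite mulr_sumr; apply: eq_bigr => j _.
  have t0 : 0 <= x0 * 2 ^+ j by rewrite mulr_ge0 ?(ltW x00)// exprn_ge0.
  have -> : (2 * x0 * 2 ^+ j) `^ r^-1 = 2 `^ r^-1 * (x0 * 2 ^+ j) `^ r^-1.
    by rewrite -mulrA; apply: powRM.
  by rewrite mulrCA; apply: powRM; rewrite ?powR_ge0// mulr_ge0 ?powR_ge0.
rewrite /c -mulrA ler_wpM2l ?powR_ge0// -powRM ?mulr_ge0 ?powR_ge0//.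
have -> : (p * u)^-1 = p^-1 / u by rewrite invfM.
apply: (sum_powR_le (z := fun j => a j * (x0 * 2 ^+ j) `^ r^-1) u0 up).
  by move=> j; rewrite mulr_ge0 ?powR_ge0.
exact: lorentz_dyadic_sum_le fW.
Qed.

Lemma measurable_abs_EFin (h : X -> R) : measurable_fun [set: X] h ->
  measurable_fun [set: X] (fun x => `|h x|%:E).
Proof.
by move=> mh; apply/measurable_EFinP; apply: (measurableT_comp (@normr_measurable R setT) mh).
Qed.

(** On a set of measure above y0 2^k the function |h| exceeds [lam k]; a subset [F k] of comparable
    size tests it. Real numbers [lam] strictly below the rearrangement are used because the latter
    is not yet known to be finite. *)
Lemma tested_sum_bound : exists2 K : R, 0 < K &
  forall (f h : X -> R) (W : R) (y0 : R) (N : nat) (lam : nat -> R),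
  measurable_fun [set: X] f -> measurable_fun [set: X] h ->
  0 <= W -> (lorentz_integral r u f <= W%:E)%E ->
  (forall F, measurable F -> (mu F < +oo)%E ->
    \int[mu]_(x in F) `|h x|%:E <= \int[mu]_x (`|f x|%:E * S' F x))%E ->
  0 < y0 -> (forall k, 0 <= lam k) ->
  (forall k, lam k = 0 \/ ((lam k)%:E < rearr mu h (y0 * 2 ^+ k))%E) ->
  \sum_(k < N) (lam k * (y0 * 2 ^+ k) `^ s^-1) `^ p^-1 <= K * W `^ (p * u)^-1.
Proof.
have p0 : 0 < p by apply: lt_trans sp; rewrite invr_gt0.
have p1 : p < 1 by apply: lt_trans pr _; rewrite invf_lt1// (lt_trans _ r1).
have [K K0 hK] := dual_bound.
have K20 : 0 < 2 * K by rewrite mulr_gt0.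
have [|K1 K10 hK1] := @sum_powR_of_dual _ (2 * K) p K20; first by rewrite p0.
exists K1 => // f h W y0 N lam mf mh W0 fW hf y00 lam0 hlam.
have Y0 k : 0 < y0 * 2 ^+ k by rewrite mulr_gt0// exprn_gt0.
have /choice[F hF] k : exists F, [/\ measurable F, (mu F <= (y0 * 2 ^+ k)%:E)%E &
    ((lam k * (y0 * 2 ^+ k) / 2)%:E <= \int[mu]_(x in F) `|h x|%:E)%E].
  have [->|lh] := hlam k.
    by exists set0; rewrite measure0 integral_set0 !mul0r lee_fin ltW.
  have := lh; rewrite rearr_gt// => lD.
  have [F [mF FA F1 F2]] := divisible (measurable_level mh _) (Y0 k) lD.
  exists F; split => //.
  apply: (@le_trans _ _ ((lam k)%:E * mu F)%E).
    by rewrite -mulrA EFinM lee_wpmul2l// lee_fin.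
  rewrite -integral_cst//; apply: ge0_le_integral => //.
  - by move=> x _; rewrite lee_fin.
  - by apply: measurable_funTS; exact: measurable_abs_EFin.
  - by move=> x /FA /= lx; rewrite lee_fin ltW.
apply: (hK1 N (fun k => lam k * (y0 * 2 ^+ k) `^ s^-1)).
  by move=> k; rewrite mulr_ge0 ?powR_ge0.
move=> y yy0.
(* Normalized so that the dual sum in [dual_bound] becomes that of [y]; since [be = 1 - s^-1], the
   factor y0 2^k from the measure of [F k] turns into its power 1/s. *)
pose b k := y k / (y0 * 2 ^+ k) `^ be.
have b0 k : 0 <= b k by rewrite divr_ge0 ?powR_ge0.
have mF k : measurable (F k) by case: (hF k).
have Fy k : (mu (F k) <= (y0 * 2 ^+ k)%:E)%E by case: (hF k).
have := hK f W F y0 N b mf W0 fW y00 mF Fy b0.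
have -> : \sum_(k < N) (b k * (y0 * 2 ^+ k) `^ be) `^ (1 - p)^-1 = \sum_(k < N) y k `^ (1 - p)^-1.
  by apply: eq_bigr => k _; rewrite /b divfK// gt_eqF// powR_gt0.
move=> H; rewrite -mulrA -ler_pdivrMl// -lee_fin; apply: le_trans H.
rewrite mulr_sumr -sumEFin; apply: lee_sum => k _.
apply: (@le_trans _ _ ((b k)%:E * (lam k * (y0 * 2 ^+ k) / 2)%:E)%E).
  rewrite -EFinM lee_fin le_eqVlt; apply/orP; left; apply/eqP; rewrite /b.
  have -> : s^-1 = 1 - be by rewrite subKr.
  rewrite powRB ?(gt_eqF (Y0 k)) ?implybT// powRr1 ?(ltW (Y0 k))//.
  by field; rewrite gt_eqF// powR_gt0.
rewrite lee_wpmul2l ?lee_fin//; case: (hF k) => _ _ /le_trans; apply.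
by apply: hf => //; apply: le_lt_trans (Fy k) _; rewrite ltry.
Qed.

Lemma lorentz_norm_bound : exists2 K : R, 0 < K &
  forall f h : X -> R,
  measurable_fun [set: X] f -> measurable_fun [set: X] h ->
  (lorentz_norm mu r u f < +oo)%E ->
  (forall F, measurable F -> (mu F < +oo)%E ->
    \int[mu]_(x in F) `|h x|%:E <= \int[mu]_x (`|f x|%:E * S' F x))%E ->
  (lorentz_norm mu s v h <= K%:E * lorentz_norm mu r u f)%E.
Proof.
have p0 : 0 < p by apply: lt_trans sp; rewrite invr_gt0.
have v0 : 0 < v by apply: lt_le_trans pv; rewrite invr_gt0.
have r0 : 0 < r by apply: lt_trans r1.
have [K K0 hK] := tested_sum_bound.
(* The factor 2^(1/s) comes from the dyadic sum of the Lorentz integral, and 2 from testing at half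
   the rearrangement. *)
exists (2 `^ s^-1 * 2 * K `^ p); first by rewrite !mulr_gt0 ?powR_gt0.
move=> f h mf mh foo hf.
have Ioo : (lorentz_integral r u f < +oo)%E.
  by apply: lty_poweRy foo; rewrite invr_eq0 gt_eqF.
pose W := fine (lorentz_integral r u f).
have W0 : 0 <= W by rewrite fine_ge0// lorentz_integral_ge0.
have IW : lorentz_integral r u f = W%:E.
  by rewrite /W fineK// ge0_fin_numE// lorentz_integral_ge0.
clearbody W.
have fW : (lorentz_integral r u f <= W%:E)%E by rewrite IW.
pose A := K * W `^ (p * u)^-1.
have A0 : 0 <= A by rewrite mulr_ge0 ?powR_ge0// ltW.
(* An infinite value would allow one test at a height [L] for which the single term is (A^p +
   1)^(1/p), exceeding [A]. *)
have fin t : 0 < t -> rearr mu h t \is a fin_num.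
  move=> t0; rewrite ge0_fin_numE ?rearr_ge0// ltNge leye_eq; apply/negP => /eqP ht.
  pose L := (A `^ p + 1) / t `^ s^-1.
  have L0 : 0 <= L by rewrite divr_ge0 ?addr_ge0 ?powR_ge0.
  have := hK f h W t 1%N (fun k => if k == 0%N then L else 0) mf mh W0 fW hf t0.
  rewrite big_ord1 expr0 mulr1/= divfK ?gt_eqF ?powR_gt0// => H.
  have : (A `^ p + 1) `^ p^-1 <= A.
    apply: H => [k|k]; first by case: ifP.
    by case: eqP => [->|]; [right; rewrite expr0 mulr1 ht ltry|left].
  rewrite leNgt => /negP; apply.
  rewrite -[ltLHS]powRr1// -[ltLHS](_ : (A `^ p) `^ p^-1 = _); last first.
    by rewrite -powRrM divff ?gt_eqF.
  by apply: gt0_ltr_powR; rewrite ?invr_gt0// ?nnegrE ?addr_ge0 ?powR_ge0// ltrDl.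
have hint : (lorentz_integral s v h <= (2 `^ (v / s) * (2 `^ p^-1 * A) `^ (v * p))%:E)%E.
  rewrite EFinM; apply: lorentz_integral_le => // N.
  set x0 : R := 2 ^- N.
  have x00 : 0 < x0 by rewrite invr_gt0 exprn_gt0.
  pose rho k := fine (rearr mu h (x0 * 2 ^+ k)).
  have rho0 k : 0 <= rho k by rewrite fine_ge0// rearr_ge0.
  have xk0 k : 0 < x0 * 2 ^+ k by rewrite mulr_gt0// exprn_gt0.
  (* Half the rearrangement is strictly below it, unless it vanishes; [tested_sum_bound] admits both
     cases. *)
  have := hK f h W x0 (N + N)%N (fun k => rho k / 2) mf mh W0 fW hf x00.
  move=> /(_ (fun k => divr_ge0 (rho0 k) (ler0n _ 2)))/(_ _)/= H.
  have {}H : \sum_(k < N + N) (rho k / 2 * (x0 * 2 ^+ k) `^ s^-1) `^ p^-1 <= A.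
    apply: H => k; have [->|rk] := eqVneq (rho k) 0; first by left; rewrite mul0r.
    right; rewrite -(fineK (fin _ (xk0 k))) lte_fin -/(rho k).
    have rk0 : 0 < rho k by rewrite lt0r rk rho0.
    by rewrite ltr_pdivrMr// ltr_pMr// ltr1n.
  rewrite (eq_bigr (fun k : 'I_(N + N) => ((rho k * (x0 * 2 ^+ k) `^ s^-1) `^ v)%:E)); last first.
    by move=> k _; rewrite lorentz_term_fine// fin.
  rewrite sumEFin lee_fin -[p in (v * p)]invrK.
  apply: (sum_powR_le (u := p^-1) (z := fun k => rho k * (x0 * 2 ^+ k) `^ s^-1)) => //.
    by rewrite invr_gt0.
    by move=> k; rewrite mulr_ge0 ?powR_ge0.
  apply: le_trans (ler_wpM2l (powR_ge0 _ _) H).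
  rewrite mulr_sumr le_eqVlt; apply/orP; left; apply/eqP; apply: eq_bigr => k _.
  by rewrite -powRM ?mulr_ge0 ?divr_ge0 ?powR_ge0//; congr (_ `^ _); field.
rewrite !lorentz_normE -/(lorentz_integral s v h) -/(lorentz_integral r u f) IW poweR_EFin.
apply: (@le_trans _ _ ((2 `^ (v / s) * (2 `^ p^-1 * A) `^ (v * p))%:E `^ v^-1)%E).
  apply: gt0_ler_poweR => //; first by rewrite invr_ge0 ltW.
  - by rewrite in_itv/= leey lorentz_integral_ge0.
  - by rewrite in_itv/= leey andbT lee_fin mulr_ge0 ?powR_ge0.
rewrite poweR_EFin -EFinM lee_fin le_eqVlt; apply/orP; left; apply/eqP.
rewrite (powRM _ (powR_ge0 _ _) (powR_ge0 _ _)) -!powRrM.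
have -> : v / s * v^-1 = s^-1 by field; rewrite !gt_eqF.
have -> : v * p / v = p by field; rewrite gt_eqF.
rewrite (powRM _ (powR_ge0 _ _) A0) /A (powRM _ (ltW K0) (powR_ge0 _ _)) -!powRrM.
rewrite invfM mulrAC !mulVf ?gt_eqF// mul1r powRr1//; ring.
Qed.

End lorentz_operator.

(** * Extension of the operator *)

Section greedy.
Context d {X : measurableType d} {R : realType}.
Implicit Types (g : X -> R).

(* Greedy expansion of a nonnegative function along the divergent series
   [sum 1 / (i + 1)]: the residual decreases to 0 pointwise. *)
Fixpoint residual g (i : nat) : X -> R := fun x =>
  if i is j.+1 then
    if j.+1%:R^-1 <= residual g j x then residual g j x - j.+1%:R^-1
    else residual g j x
  else g x.

Definition greedy_set g (i : nat) : set X := [set x | i.+1%:R^-1 <= residual g i x].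

Lemma residualS g i x :
  residual g i.+1 x = residual g i x - i.+1%:R^-1 * \1_(greedy_set g i) x.
Proof.
rewrite /= indicE; case: ifPn => h.
  by rewrite mem_set// mulr1.
by rewrite memNset ?mulr0 ?subr0//; apply/negP.
Qed.

Lemma residual_ge0 g i x : 0 <= g x -> 0 <= residual g i x.
Proof. by move=> g0; elim: i => //= i IH; case: ifPn => //; rewrite subr_ge0. Qed.

Lemma measurable_residual g i : measurable_fun [set: X] g ->
  measurable_fun [set: X] (residual g i).
Proof.
move=> mg; elim: i => // i IH.
rewrite (_ : residual g i.+1 = (residual g i \- (fun x => i.+1%:R^-1 * \1_(greedy_set g i) x))).
  apply: measurable_funB => //; apply: measurable_funM => //.
  apply: measurable_indic; rewrite /greedy_set -[X in measurable X]setTI.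
  have -> : [set x | i.+1%:R^-1 <= residual g i x] = residual g i @^-1` `[i.+1%:R^-1, +oo[%classic.
    by apply/seteqP; split => x /=; rewrite in_itv/= andbT.
  exact: IH.
by apply/funext => x; exact: residualS.
Qed.

Lemma measurable_greedy_set g i : measurable_fun [set: X] g -> measurable (greedy_set g i).
Proof.
move=> /(measurable_residual i) mr; rewrite /greedy_set -[X in measurable X]setTI.
have -> : [set x | i.+1%:R^-1 <= residual g i x] = residual g i @^-1` `[i.+1%:R^-1, +oo[%classic.
  by apply/seteqP; split => x /=; rewrite in_itv/= andbT.
exact: mr.
Qed.

Lemma residual_sum g i x :
  \sum_(0 <= j < i) j.+1%:R^-1 * \1_(greedy_set g j) x = g x - residual g i x.
Proof.
elim: i => [|i IH]; first by rewrite big_nil subrr.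
by rewrite big_nat_recr//= IH -/(residual g i.+1 x) residualS; ring.
Qed.

(** With a positive limit, [x] would lie in every greedy set from some index on, and a tail of the
    harmonic series would be bounded by [g x]. *)
Lemma residual_cvg0 g x : 0 <= g x -> residual g ^~ x @ \oo --> (0 : R).
Proof.
move=> g0.
have r0 i : 0 <= residual g i x by exact: residual_ge0.
have nir : nonincreasing_seq (residual g ^~ x).
  apply/nonincreasing_seqP => i; rewrite residualS gerBl mulr_ge0//.
have cv : cvgn (residual g ^~ x).
  by apply: nonincreasing_is_cvgn => //; exists 0 => _ [i _ <-].
have l0 : 0 <= limn (residual g ^~ x) by apply: limr_ge => //; near=> i.
suff l00 : limn (residual g ^~ x) <= 0.
  suff <- : limn (residual g ^~ x) = 0 by [].
  by apply/eqP; rewrite eq_le l00.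
rewrite leNgt; apply/negP => lp.
have rl i : limn (residual g ^~ x) <= residual g i x by exact: nonincreasing_cvgn_ge.
pose N := (Num.truncn (limn (residual g ^~ x))^-1).
have inA i : (N <= i)%N -> greedy_set g i x.
  move=> Ni; rewrite /greedy_set/=; apply: le_trans (rl i).
  rewrite invf_ple ?posrE//; apply: ltW; apply: lt_le_trans (truncnS_gt _) _.
  by rewrite ler_nat.
apply: (@dvg_harmonic R).
apply: (@nondecreasing_is_cvgn _ (series harmonic)).
  by apply: nondecreasing_series => i _ _; exact: harmonic_ge0.
exists (series (@harmonic R) N + g x) => _ [i _ <-].
have [iN|Ni] := leqP i N.
  apply: ler_wpDr => //; apply: nondecreasing_series => // j _ _; exact: harmonic_ge0.
rewrite -lerBlDl sub_series_geq ?(ltnW Ni)//.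
apply: (@le_trans _ _ (\sum_(0 <= j < i) j.+1%:R^-1 * \1_(greedy_set g j) x)); last first.
  by rewrite residual_sum gerBl.
rewrite [leRHS](big_cat_nat (n := N))//=; last exact: ltnW.
rewrite -[leLHS]add0r lerD//; first by rewrite sumr_ge0// => j _; rewrite mulr_ge0.
rewrite !big_nat; apply: ler_sum => j /andP[Nj _].
by rewrite indicE mem_set ?mulr1//; exact: inA.
Unshelve. all: by end_near. Qed.

Lemma greedy_series g x : 0 <= g x ->
  (\sum_(0 <= i <oo) (i.+1%:R^-1 * \1_(greedy_set g i) x)%:E)%E = (g x)%:E.
Proof.
move=> g0; apply/cvg_lim => //.
rewrite (_ : (fun n => _) = EFin \o (fun n => g x - residual g n x)); last first.
  by apply/funext => i /=; rewrite sumEFin residual_sum.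
apply: cvg_EFin; first by near=> i.
rewrite -[X in _ --> X]subr0; apply: cvgB; first exact: cvg_cst.
exact: residual_cvg0.
Unshelve. all: by end_near. Qed.

(** The factor stands for [S' F x], which may be +oo. In that case either some greedy set contains
    [x] and both sides are +oo, or [g x] is 0 and both vanish. *)
Lemma greedy_seriesM g x (y : \bar R) : 0 <= g x -> (0 <= y)%E ->
  (\sum_(0 <= i <oo) ((i.+1%:R^-1 * \1_(greedy_set g i) x)%:E * y) = (g x)%:E * y)%E.
Proof.
move=> g0; have t0 i : (0 <= (i.+1%:R^-1 * \1_(greedy_set g i) x)%:E)%E.
  by rewrite lee_fin mulr_ge0.
case: y => [y y0|_|//].
  under eq_eseriesr do rewrite muleC.
  by rewrite nneseriesZl// greedy_series// muleC.
have ty0 i : (0 <= (i.+1%:R^-1 * \1_(greedy_set g i) x)%:E * +oo)%E by rewrite mule_ge0.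
have [[i Ai]|/forallNP nA] := pselect (exists i, greedy_set g i x).
  rewrite (nneseries_pinfty _ (k := i))//; last first.
    by rewrite indicE mem_set// mulr1 gt0_muley// lte_fin.
  rewrite gt0_muley// lte_fin; apply: (@lt_le_trans _ _ i.+1%:R^-1) => //.
  apply: le_trans Ai _; by rewrite -subr_ge0 -residual_sum sumr_ge0.
have t00 i : (i.+1%:R^-1 * \1_(greedy_set g i) x)%:E = 0%E.
  by rewrite indicE memNset// mulr0.
rewrite -greedy_series// !eseries0 ?mul0e// => i _ _; by rewrite t00 ?mul0e.
Qed.

End greedy.

(** * Extension by duality *)

Section uniqueness.
Context d {X : measurableType d} {R : realType} (mu : {measure set X -> \bar R}).
Variable U : nat -> set X.
Hypotheses (mU : forall i, measurable (U i)) (Uoo : forall i, (mu (U i) < +oo)%E).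
Hypothesis UT : \bigcup_i U i = setT.

Lemma ae_cover (P : X -> Prop) :
  (forall i, {ae mu, forall x, U i x -> P x}) -> {ae mu, forall x, P x}.
Proof.
move=> /ae_foralln; apply: filterS => x h.
have [i _ Ux] : (\bigcup_i U i) x by rewrite UT.
exact: h Ux.
Qed.

Lemma ae_eq_of_integrals (f g : X -> \bar R) :
  measurable_fun [set: X] f -> measurable_fun [set: X] g ->
  (forall x, 0 <= f x)%E ->
  (forall F, measurable F -> (mu F < +oo)%E -> \int[mu]_(x in F) f x < +oo)%E ->
  (forall F, measurable F -> (mu F < +oo)%E ->
     \int[mu]_(x in F) f x = \int[mu]_(x in F) g x)%E ->
  {ae mu, forall x, f x = g x}.
Proof.
move=> mf mg f0 foo fg; apply: ae_cover => i.
apply: (integral_ae_eq (mU i)).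
- apply/integrableP; split; first exact: measurable_funTS.
  under eq_integral do rewrite gee0_abs//.
  exact: foo.
- exact: measurable_funTS.
- move=> F FU mF; apply: fg => //; apply: le_lt_trans (Uoo i).
  by apply: le_measure; rewrite ?inE.
Qed.

Variables (S S' : set X -> X -> \bar R).
Hypotheses (S0 : nonneg_measurable S) (S'0 : nonneg_measurable S').
Hypothesis SS' : adjoint mu S S'.

Definition extension_series (g : X -> R) (x : X) : \bar R :=
  (\sum_(0 <= i <oo) (i.+1%:R^-1)%:E * S (greedy_set g i) x)%E.

Definition positive_extension (g : X -> R) (x : X) : R := fine (extension_series g x).

Definition extension (f : X -> R) (x : X) : R :=
  positive_extension (fun y => Num.max (f y) 0) x
  - positive_extension (fun y => Num.max (- f y) 0) x.

(** A domain defined by duality: stable under linear combinations, and enough to make the series of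
    both parts of [f] finite almost everywhere. *)
Definition extendable (f : X -> R) := measurable_fun [set: X] f /\
  forall F, measurable F -> (mu F < +oo)%E -> (\int[mu]_x (`|f x|%:E * S' F x) < +oo)%E.

Section nonnegative.
Variable g : X -> R.
Hypotheses (mg : measurable_fun [set: X] g) (g0 : forall x, 0 <= g x).

Let term_ge0 i x : (0 <= (i.+1%:R^-1)%:E * S (greedy_set g i) x)%E.
Proof. by rewrite mule_ge0// (S0 (measurable_greedy_set i mg)).2. Qed.

Lemma extension_series_ge0 x : (0 <= extension_series g x)%E.
Proof. by apply: nneseries_ge0. Qed.

Lemma measurable_extension_series : measurable_fun [set: X] (extension_series g).
Proof.
apply: (@ge0_emeasurable_sum _ _ _ _ (fun i x => (i.+1%:R^-1)%:E * S (greedy_set g i) x)%E xpredT) => //.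
by move=> i _; apply: measurable_funeM; exact: (S0 (measurable_greedy_set i mg)).1.
Qed.

(** Sum and integral commute by positivity, and the adjoint acts on each greedy set. The right-hand
    side no longer sees the greedy sets and is additive in [g]. *)
Lemma integral_extension_series F : measurable F ->
  (\int[mu]_(x in F) extension_series g x = \int[mu]_x ((g x)%:E * S' F x))%E.
Proof.
move=> mF; have mA i := measurable_greedy_set i mg.
have S'ge x : (0 <= S' F x)%E by exact: (S'0 mF).2.
have mS' := (S'0 mF).1.
rewrite /extension_series integral_nneseries//; last first.
  by move=> i; apply: measurable_funTS; apply: measurable_funeM; exact: (S0 (mA i)).1.
transitivity (\sum_(0 <= i <oo) \int[mu]_x ((i.+1%:R^-1 * \1_(greedy_set g i) x)%:E * S' F x))%E.
  apply: eq_eseriesr => i _.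
  rewrite ge0_integralZl//; last 2 first.
  - by apply: measurable_funTS; exact: (S0 (mA i)).1.
  - by move=> x _; exact: (S0 (mA i)).2.
  rewrite SS'// integral_mkcond -ge0_integralZl//; last 2 first.
  - by apply/(measurable_restrictT _ (mA i)); exact: measurable_funTS.
  - by move=> x _; rewrite patchE; case: ifP.
  apply: eq_integral => x _; rewrite EFinM -muleA patchE indicE.
  by case: ifP => _; rewrite ?mul1e ?mul0e.
rewrite -integral_nneseries//; last 2 first.
- move=> i; apply: emeasurable_funM => //; apply/measurable_EFinP.
  by apply: measurable_funM => //; exact: measurable_indic.
- by move=> i x _; rewrite mule_ge0// lee_fin.
by apply: eq_integral => x _; rewrite greedy_seriesM.
Qed.

End nonnegative.
End uniqueness.

Section extension.
Context d {X : measurableType d} {R : realType} (mu : {measure set X -> \bar R}).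
Variable U : nat -> set X.
Hypotheses (mU : forall i, measurable (U i)) (Uoo : forall i, (mu (U i) < +oo)%E).
Hypothesis UT : \bigcup_i U i = setT.
Variables (S S' : set X -> X -> \bar R).
Hypotheses (S0 : nonneg_measurable S) (S'0 : nonneg_measurable S').
Hypothesis SS' : adjoint mu S S'.

Implicit Types (f g h : X -> R) (F E : set X).
Local Notation extendable := (extendable mu S').
Local Notation T1 := (positive_extension S).
Local Notation T := (extension S).

Lemma measurable_weighted (g : X -> R) F : measurable F -> measurable_fun [set: X] g ->
  measurable_fun [set: X] (fun x => (g x)%:E * S' F x)%E.
Proof.
by move=> mF mg; apply: emeasurable_funM; [exact/measurable_EFinP|exact: (S'0 mF).1].
Qed.

Lemma weighted_ge0 (g : X -> R) F x : measurable F -> 0 <= g x ->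
  (0 <= (g x)%:E * S' F x)%E.
Proof. by move=> mF g0; rewrite mule_ge0 ?lee_fin// (S'0 mF).2. Qed.

Lemma positive_extension_ge0 g x : measurable_fun [set: X] g -> 0 <= T1 g x.
Proof. by move=> mg; apply: fine_ge0; exact: extension_series_ge0. Qed.

Lemma measurable_positive_extension g : measurable_fun [set: X] g ->
  measurable_fun [set: X] (T1 g).
Proof.
move=> mg; apply: measurableT_comp; first exact: fine_measurable.
exact: measurable_extension_series.
Qed.

Lemma positive_extension_integral g F : extendable g -> (forall x, 0 <= g x) ->
  measurable F ->
  (\int[mu]_(x in F) (T1 g x)%:E = \int[mu]_x ((g x)%:E * S' F x))%E.
Proof.
move=> [mg hg] g0 mF.
have ms := measurable_extension_series S0 mg.
have s0 := extension_series_ge0 S0 mg.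
rewrite -(integral_extension_series S0 S'0 SS' mg g0 mF).
apply: ge0_ae_eq_integral => //.
- by apply/measurable_EFinP/measurable_funTS; exact: measurable_positive_extension.
- exact: measurable_funTS.
- by move=> x _; rewrite lee_fin positive_extension_ge0.
(* Taking [fine] is harmless: on each [U i] the series has a finite integral, and these sets cover
   the space. *)
have : {ae mu, forall x, extension_series S g x \is a fin_num}.
  apply: (ae_cover UT) => i; apply: integrable_ae; first exact: mU.
  apply/integrableP; split; first exact: measurable_funTS.
  under eq_integral do rewrite gee0_abs//.
  rewrite (integral_extension_series S0 S'0 SS' mg g0 (mU i)).
  apply: le_lt_trans (hg _ (mU i) (Uoo i)); rewrite le_eqVlt; apply/orP; left; apply/eqP.
  by apply: eq_integral => x _; rewrite ger0_norm.
by apply: filterS => x xf _; rewrite /positive_extension fineK.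
Qed.

Lemma extendable_le g f : measurable_fun [set: X] g -> extendable f ->
  (forall x, `|g x| <= `|f x|) -> extendable g.
Proof.
move=> mg [mf hf] gf; split => // F mF Foo; apply: le_lt_trans (hf F mF Foo).
have mn h : measurable_fun [set: X] h -> measurable_fun [set: X] (fun x : X => `|h x| : R).
  by move=> mh; apply: (measurableT_comp (@normr_measurable R setT) mh).
apply: ge0_le_integral => //.
- by move=> x _; apply: (weighted_ge0 (g := fun x => `|g x|)).
- by apply: (measurable_weighted (g := fun x => `|g x|)) => //; exact: mn.
- by apply: (measurable_weighted (g := fun x => `|f x|)) => //; exact: mn.
- by move=> x _; rewrite lee_wpmul2r ?lee_fin// (S'0 mF).2.
Qed.

Lemma measurable_pos_part f : measurable_fun [set: X] f ->
  measurable_fun [set: X] (fun x => Num.max (f x) 0 : R).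
Proof. by move=> mf; apply: measurable_maxr. Qed.

Lemma measurable_neg_part f : measurable_fun [set: X] f ->
  measurable_fun [set: X] (fun x => Num.max (- f x) 0 : R).
Proof. by move=> mf; apply: measurable_maxr => //; exact: measurableT_comp. Qed.

Lemma extendable_pos f : extendable f -> extendable (fun x => Num.max (f x) 0).
Proof.
move=> ef; have [mf _] := ef; apply: extendable_le ef _; first exact: measurable_pos_part.
by move=> x; case: (leP (f x) 0) => // h; rewrite normr0.
Qed.

Lemma extendable_neg f : extendable f -> extendable (fun x => Num.max (- f x) 0).
Proof.
move=> ef; have [mf _] := ef; apply: extendable_le ef _; first exact: measurable_neg_part.
by move=> x; case: (leP (- f x) 0) => // h; rewrite ?normr0// normrN.
Qed.

Lemma measurable_extension f : measurable_fun [set: X] f -> measurable_fun [set: X] (T f).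
Proof.
move=> mf; apply: measurable_funB; apply: measurable_positive_extension.
  exact: measurable_pos_part.
exact: measurable_neg_part.
Qed.

Lemma integral_combination (A : set X) (h1 h2 h3 : X -> \bar R) (w : R) :
  measurable A -> 0 <= w ->
  measurable_fun A h1 -> measurable_fun A h2 -> measurable_fun A h3 ->
  (forall x, A x -> 0 <= h1 x)%E -> (forall x, A x -> 0 <= h2 x)%E ->
  (forall x, A x -> 0 <= h3 x)%E ->
  (\int[mu]_(x in A) (h1 x + w%:E * h2 x + h3 x) =
   \int[mu]_(x in A) h1 x + w%:E * \int[mu]_(x in A) h2 x + \int[mu]_(x in A) h3 x)%E.
Proof.
move=> mA w0 m1 m2 m3 h10 h20 h30.
have mw : measurable_fun A (fun x => w%:E * h2 x)%E by exact: measurable_funeM.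
have hw x : A x -> (0 <= w%:E * h2 x)%E by move=> Ax; rewrite mule_ge0 ?lee_fin ?h20.
rewrite ge0_integralD//; last 2 first.
- by move=> x Ax; rewrite adde_ge0 ?h10 ?hw.
- exact: emeasurable_funD.
by rewrite ge0_integralD// ge0_integralZl ?lee_fin.
Qed.

Lemma positive_combination (p1 p2 p3 : X -> R) (w : R) F : 0 <= w -> measurable F ->
  extendable p1 -> extendable p2 -> extendable p3 ->
  (forall x, 0 <= p1 x) -> (forall x, 0 <= p2 x) -> (forall x, 0 <= p3 x) ->
  (\int[mu]_(x in F) (T1 p1 x + w * T1 p2 x + T1 p3 x)%:E =
   \int[mu]_x ((p1 x + w * p2 x + p3 x)%:E * S' F x))%E /\
  ((mu F < +oo)%E -> (\int[mu]_(x in F) (T1 p1 x + w * T1 p2 x + T1 p3 x)%:E < +oo)%E).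
Proof.
move=> w0 mF e1 e2 e3 p10 p20 p30.
have [[m1 _] [m2 _] [m3 _]] := And3 e1 e2 e3.
have mT p : measurable_fun [set: X] p -> measurable_fun F (fun x => (T1 p x)%:E).
  by move=> mp; apply/measurable_EFinP/measurable_funTS; exact: measurable_positive_extension.
have T0 p x : measurable_fun [set: X] p -> F x -> (0 <= (T1 p x)%:E)%E.
  by move=> mp _; rewrite lee_fin positive_extension_ge0.
have E1 : (\int[mu]_(x in F) (T1 p1 x + w * T1 p2 x + T1 p3 x)%:E =
    \int[mu]_(x in F) (T1 p1 x)%:E + w%:E * \int[mu]_(x in F) (T1 p2 x)%:E
    + \int[mu]_(x in F) (T1 p3 x)%:E)%E.
  rewrite -(integral_combination mF w0 (mT _ m1) (mT _ m2) (mT _ m3)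
    (fun x => @T0 _ x m1) (fun x => @T0 _ x m2) (fun x => @T0 _ x m3)).
  by apply: eq_integral => x _; rewrite !EFinD EFinM.
split; last first.
  move=> Foo; rewrite E1 !positive_extension_integral//.
  have fin p : extendable p -> (forall x, 0 <= p x) -> (\int[mu]_x ((p x)%:E * S' F x) < +oo)%E.
    move=> [_ hp] p0; have := hp F mF Foo.
    by under eq_integral do rewrite ger0_norm//.
  apply: lte_add_pinfty; last exact: fin.
  apply: lte_add_pinfty; first exact: fin.
  by apply: lte_mul_pinfty; rewrite ?lee_fin//; exact: fin.
rewrite E1 !positive_extension_integral//.
rewrite -(integral_combination measurableT w0 (measurable_weighted mF m1)
  (measurable_weighted mF m2) (measurable_weighted mF m3)
  (fun x _ => weighted_ge0 mF (p10 x)) (fun x _ => weighted_ge0 mF (p20 x))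
  (fun x _ => weighted_ge0 mF (p30 x))).
apply: eq_integral => x _; have wp : 0 <= w * p2 x by rewrite mulr_ge0.
by rewrite !EFinD !ge0_muleDl ?EFinM ?muleA// -?EFinM -?EFinD lee_fin ?addr_ge0.
Qed.

(** Both sides have equal, finite integrals over every set of finite measure. Keeping all terms
    nonnegative avoids differences of possibly infinite quantities. *)
Lemma positive_combination_eq (p1 p2 p3 q1 q2 q3 : X -> R) (w : R) : 0 <= w ->
  extendable p1 -> extendable p2 -> extendable p3 ->
  extendable q1 -> extendable q2 -> extendable q3 ->
  (forall x, 0 <= p1 x) -> (forall x, 0 <= p2 x) -> (forall x, 0 <= p3 x) ->
  (forall x, 0 <= q1 x) -> (forall x, 0 <= q2 x) -> (forall x, 0 <= q3 x) ->
  (forall x, p1 x + w * p2 x + p3 x = q1 x + w * q2 x + q3 x) ->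
  {ae mu, forall x, T1 p1 x + w * T1 p2 x + T1 p3 x = T1 q1 x + w * T1 q2 x + T1 q3 x}.
Proof.
move=> w0 e1 e2 e3 e4 e5 e6 p10 p20 p30 q10 q20 q30 pq.
have mT p1' p2' p3' : extendable p1' -> extendable p2' -> extendable p3' ->
    measurable_fun [set: X] (fun x => (T1 p1' x + w * T1 p2' x + T1 p3' x)%:E).
  move=> [m1 _] [m2 _] [m3 _]; apply/measurable_EFinP.
  apply: measurable_funD; last exact: measurable_positive_extension.
  apply: measurable_funD; first exact: measurable_positive_extension.
  by apply: measurable_funM => //; exact: measurable_positive_extension.
have : {ae mu, forall x, (T1 p1 x + w * T1 p2 x + T1 p3 x)%:E = (T1 q1 x + w * T1 q2 x + T1 q3 x)%:E}.
  apply: (ae_eq_of_integrals mU Uoo UT); [exact: mT|exact: mT| | |].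
  - have [[m1 _] [m2 _] [m3 _]] := And3 e1 e2 e3.
    by move=> x; rewrite lee_fin !addr_ge0 ?mulr_ge0 ?positive_extension_ge0.
  - by move=> F mF; have [_ ] := positive_combination w0 mF e1 e2 e3 p10 p20 p30.
  - move=> F mF _.
    have [-> _] := positive_combination w0 mF e1 e2 e3 p10 p20 p30.
    have [-> _] := positive_combination w0 mF e4 e5 e6 q10 q20 q30.
    by apply: eq_integral => x _; rewrite pq.
by apply: filterS => x [].
Qed.

Lemma extendable_comb (f g : X -> R) (c : R) : extendable f -> extendable g ->
  extendable (fun x => c * f x + g x).
Proof.
move=> [mf hf] [mg hg]; split.
  by apply: measurable_funD => //; apply: measurable_funM.
move=> F mF Foo.
have mn h : measurable_fun [set: X] h -> measurable_fun [set: X] (fun x : X => `|h x| : R).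
  by move=> mh; apply: (measurableT_comp (@normr_measurable R setT) mh).
apply: (@le_lt_trans _ _ (\int[mu]_x (0%E + `|c|%:E * (`|f x|%:E * S' F x) + (`|g x|%:E * S' F x)))%E).
  apply: ge0_le_integral => //.
  - by move=> x _; apply: (weighted_ge0 (g := fun x => `|c * f x + g x|)).
  - apply: (measurable_weighted (g := fun x => `|c * f x + g x|)) => //; apply: mn.
    by apply: measurable_funD => //; apply: measurable_funM.
  - apply: emeasurable_funD; last by apply: (measurable_weighted (g := fun x => `|g x|)) => //; exact: mn.
    apply: emeasurable_funD => //; apply: measurable_funeM.
    by apply: (measurable_weighted (g := fun x => `|f x|)) => //; exact: mn.
  - move=> x _; have S'x := (S'0 mF).2 x.
    rewrite add0e muleA -EFinM -ge0_muleDl ?lee_fin// lee_wpmul2r// -EFinD lee_fin -normrM.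
    exact: ler_normD.
rewrite integral_combination//; last 4 first.
- by apply: (measurable_weighted (g := fun x => `|f x|)) => //; exact: mn.
- by apply: (measurable_weighted (g := fun x => `|g x|)) => //; exact: mn.
- by move=> x _; apply: (weighted_ge0 (g := fun x => `|f x|)).
- by move=> x _; apply: (weighted_ge0 (g := fun x => `|g x|)).
rewrite integral0 add0e lte_add_pinfty ?hg//.
by apply: lte_mul_pinfty; rewrite ?lee_fin// hf.
Qed.

(** For k = c f + g the identity is split into positive and negative parts, all moved to the side
    where their sign is plus. For c < 0 the parts of [f] change sides and the weight is -c. *)
Lemma extension_linear (f g : X -> R) (c : R) : extendable f -> extendable g ->
  {ae mu, forall x, T (fun y => c * f y + g y) x = c * T f x + T g x}.
Proof.
move=> ef eg; have ek := extendable_comb c ef eg.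
have pos h x : 0 <= Num.max (h x) 0 :> R by rewrite le_max lexx orbT.
have partE (z : R) : z = Num.max z 0 - Num.max (- z) 0.
  by rewrite /Num.max; do 2 case: ifP; lra.
have kE x : Num.max (c * f x + g x) 0 - Num.max (- (c * f x + g x)) 0 =
    c * (Num.max (f x) 0 - Num.max (- f x) 0) + (Num.max (g x) 0 - Num.max (- g x) 0).
  by rewrite -!partE.
have [c0|c0] := leP 0 c.
  apply: filterS (positive_combination_eq (w := c) c0 (extendable_pos ek) (extendable_neg ef)
    (extendable_neg eg) (extendable_neg ek) (extendable_pos ef) (extendable_pos eg)
    (pos _) (pos _) (pos _) (pos _) (pos _) (pos _) _) => [x /=|x]; last by have := kE x; lra.
  by rewrite /extension; lra.
have c0' : 0 <= - c by lra.
apply: filterS (positive_combination_eq c0' (extendable_pos ek) (extendable_pos ef)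
  (extendable_neg eg) (extendable_neg ek) (extendable_neg ef) (extendable_pos eg)
  (pos _) (pos _) (pos _) (pos _) (pos _) (pos _) _) => [x /=|x]; last by have := kE x; lra.
by rewrite /extension; lra.
Qed.

(** The domination that [lorentz_norm_bound] requires, obtained from both parts of [f]
    separately. *)
Lemma extension_abs_integral (f : X -> R) F : extendable f -> measurable F ->
  (\int[mu]_(x in F) `|T f x|%:E <= \int[mu]_x (`|f x|%:E * S' F x))%E.
Proof.
move=> ef mF; have [mf _] := ef.
have [ep en] := (extendable_pos ef, extendable_neg ef).
have pos h x : 0 <= Num.max (h x) 0 :> R by rewrite le_max lexx orbT.
have mp := measurable_pos_part mf; have mn := measurable_neg_part mf.
have mT h : measurable_fun [set: X] h -> measurable_fun F (fun x => (T1 h x)%:E).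
  by move=> mh; apply/measurable_EFinP/measurable_funTS; exact: measurable_positive_extension.
apply: (@le_trans _ _ (\int[mu]_(x in F) ((T1 (fun x => Num.max (f x) 0) x)%:E
    + (T1 (fun x => Num.max (- f x) 0) x)%:E))%E).
  apply: ge0_le_integral => //.
  - apply/measurable_EFinP/measurable_funTS.
    exact: (measurableT_comp (@normr_measurable R setT) (measurable_extension mf)).
  - by apply: emeasurable_funD; exact: mT.
  - move=> x _; rewrite -EFinD lee_fin; apply: le_trans (ler_normB _ _) _.
    by rewrite !ger0_norm// positive_extension_ge0.
rewrite ge0_integralD//; [|by move=> x _; rewrite lee_fin positive_extension_ge0|exact: mT
  |by move=> x _; rewrite lee_fin positive_extension_ge0|exact: mT].
rewrite (positive_extension_integral ep (pos _) mF) (positive_extension_integral en (pos _) mF).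
have w1 x : (0 <= (Num.max (f x) 0)%:E * S' F x)%E
  by rewrite mule_ge0 ?lee_fin ?le_max ?lexx ?orbT// (S'0 mF).2.
have w2 x : (0 <= (Num.max (- f x) 0)%:E * S' F x)%E.
  by rewrite mule_ge0 ?lee_fin ?le_max ?lexx ?orbT// (S'0 mF).2.
have m1 := measurable_weighted mF mp; have m2 := measurable_weighted mF mn.
rewrite -ge0_integralD// le_eqVlt; apply/orP; left; apply/eqP; apply: eq_integral => x _.
have f1 := pos f x; have f2 := pos (fun x => - f x) x.
rewrite -ge0_muleDl ?lee_fin// -EFinD; congr (_%:E * _)%E.
have [h|/ltW h] := leP 0 (f x).
  by rewrite ger0_norm// ?(max_idPl h) (max_idPr _) ?addr0// oppr_le0.
by rewrite ler0_norm// ?(max_idPr h) (max_idPl _) ?add0r// oppr_ge0.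
Qed.

Lemma extension_indic (E : set X) : measurable E -> extendable \1_E ->
  {ae mu, forall x, (T \1_E x)%:E = S E x}.
Proof.
move=> mE eE.
have pE : (fun x => Num.max (\1_E x) 0) = \1_E :> (X -> R).
  by apply/funext => x; apply/max_idPl.
have nE : (fun x => Num.max (- \1_E x) 0) = (fun=> 0) :> (X -> R).
  by apply/funext => x; apply/max_idPr; rewrite oppr_le0.
have e0 : extendable (fun=> 0).
  by have := extendable_neg eE; rewrite nE.
have mT p : measurable_fun [set: X] p -> measurable_fun [set: X] (fun x => (T1 p x)%:E).
  by move=> mp; apply/measurable_EFinP; exact: measurable_positive_extension.
have z0 : {ae mu, forall x, (T1 (fun=> 0) x)%:E = 0%E}.
  apply: (ae_eq_of_integrals mU Uoo UT) => //.
  - by apply: mT.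
  - by move=> x; rewrite lee_fin positive_extension_ge0.
  - move=> F mF _; rewrite positive_extension_integral//.
    by under eq_integral do rewrite mul0e; rewrite integral0.
  - move=> F mF _; rewrite positive_extension_integral// integral0.
    by under eq_integral do rewrite mul0e; rewrite integral0.
have z1 : {ae mu, forall x, (T1 \1_E x)%:E = S E x}.
  have [m1 h1] := eE.
  have ge1 x : 0 <= \1_E x :> R by [].
  apply: (ae_eq_of_integrals mU Uoo UT) => //.
  - by apply: mT.
  - exact: (S0 mE).1.
  - by move=> x; rewrite lee_fin positive_extension_ge0.
  - move=> F mF Foo; rewrite positive_extension_integral//; have := h1 F mF Foo.
    by under eq_integral do rewrite ger0_norm//.
  - move=> F mF _; rewrite positive_extension_integral// SS'// [RHS]integral_mkcond.
    apply: eq_integral => x _; rewrite patchE indicE.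
    by case: ifP => _; rewrite ?mul1e ?mul0e.
apply: filterS2 z0 z1 => x [h0] h1.
by rewrite /extension pE nE h0 subr0 h1.
Qed.

End extension.

(** * The theorem *)

Section lebesgue_cover.
Context {R : realType} {n : nat} (mu : {measure set (n.-tuple R) -> \bar R}).
Hypotheses (n_gt0 : (0 < n)%N) (mu_leb : is_lebesgue_Rn mu).
Local Notation X := (n.-tuple R).

Lemma measurable_box (a b : X) : measurable (box a b).
Proof.
have -> : box a b = \bigcap_(i in [set: 'I_n]) ((@tnth n R)^~ i @^-1` `[tnth a i, tnth b i]%classic).
  apply/seteqP; split => [x h i _|x h i] /=; rewrite ?in_itv/=; first exact: h.
  by have := h i I; rewrite /= in_itv.
apply: fin_bigcap_measurable => [|i _]; first exact: finite_finset.
by rewrite -[X in measurable X]setTI; apply: measurable_tnth => //; exact: measurable_itv.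
Qed.

Lemma small_cover (e : R) : 0 < e -> exists U : nat -> set X,
  [/\ forall i, measurable (U i), forall i, (mu (U i) <= e%:E)%E & \bigcup_i U i = setT].
Proof.
(* Cubes of side [del] on the lattice [del] Z^n: as [del <= 1] and [n] is positive, their volume is
   at most [del], hence at most [e]. *)
move=> e0; pose del := Num.min 1 e.
have d0 : 0 < del by rewrite lt_min ltr01.
pose corner (z : n.-tuple int) (c : R) : X := [tuple del * ((tnth z i)%:~R + c) | i < n].
pose Q z := box (corner z 0) (corner z 1).
have mQ z : (mu (Q z) <= e%:E)%E.
  rewrite /Q mu_leb => [|i]; last by rewrite !tnth_mktuple ler_pM2l// lerD2l ler01.
  rewrite (eq_bigr (fun=> del%:E)) => [|i _]; last first.
    by rewrite !tnth_mktuple; congr EFin; ring.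
  rewrite prodEFin lee_fin prodr_const card_ord.
  apply: (@le_trans _ _ del); last by rewrite ge_min lexx orbT.
  by rewrite -(prednK n_gt0) exprS ler_piMr ?(ltW d0)// exprn_ile1 ?(ltW d0)// ge_min lexx.
exists (fun i => if unpickle i is Some z then Q z else set0); split.
- by move=> i; case: unpickle => [z|]; [exact: measurable_box|exact: measurable0].
- by move=> i; case: unpickle => [z|]; [exact: mQ|rewrite measure0 lee_fin ltW].
- apply/seteqP; split => // x _.
  exists (pickle [tuple Num.floor (tnth x i / del) | i < n]) => //=.
  rewrite pickleK => i; rewrite !tnth_mktuple addr0.
  have := floor_le (tnth x i / del); have := ltW (floorD1_gt (tnth x i / del)).
  by rewrite ler_pdivrMr// ler_pdivlMr// intrD1 !(mulrC del) => -> ->.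
Qed.

(** Pieces of measure at most c/2 are added one by one; the first union exceeding c/2 still has
    measure at most c. *)
Lemma atomless (A : set X) (c : R) : measurable A -> 0 < c -> (c%:E < mu A)%E ->
  exists F, [/\ measurable F, F `<=` A, ((c / 2)%:E <= mu F)%E & (mu F <= c%:E)%E].
Proof.
move=> mA c0 cA; have c20 : 0 < c / 2 by rewrite divr_gt0.
have [U [mU Uc UT]] := small_cover c20.
pose V i := A `&` \big[setU/set0]_(j < i) U j.
have mV i : measurable (V i) by apply: measurableI => //; exact: bigsetU_measurable.
have VA : \bigcup_i V i = A.
  rewrite -setI_bigcupr; apply/seteqP; split => [x []//|x Ax]; split => //.
  have [i _ Ui] : (\bigcup_i U i) x by rewrite UT.
  by exists i.+1 => //; rewrite big_ord_recr/=; right.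
have cv : mu \o V @ \oo --> mu A.
  rewrite -VA; apply: nondecreasing_cvg_mu => //; first by rewrite VA.
  by move=> i j ij; apply/subsetPset; apply: setIS; exact: subset_bigsetU.
have ex : exists i, ((c / 2)%:E < mu (V i))%E.
  apply: contrapT => /forallNP h; move: cA; apply/negP; rewrite -leNgt.
  apply: (@le_trans _ _ (c / 2)%:E); last by rewrite lee_fin ler_pdivrMr// ler_peMr ?(ltW c0)// ler1n.
  rewrite -(cvg_lim _ cv)//; apply: lime_le; first by apply/cvg_ex; eexists; exact: cv.
  by near=> i; rewrite leNgt; apply/negP/h.
case: (ex_minnP ex) => -[|i] ci mini.
  by move: ci; rewrite /V big_ord0 setI0 measure0 lte_fin ltNge (ltW c20).
exists (V i.+1); split => //; [by move=> x []|exact: ltW|].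
apply: (@le_trans _ _ (mu (V i) + mu (A `&` U i))%E).
  by rewrite /V big_ord_recr/= setIUr; apply: measureU2; [exact: mV|exact: measurableI].
have -> : c%:E = ((c / 2)%:E + (c / 2)%:E)%E by rewrite -EFinD; congr EFin; field.
apply: leeD.
  by rewrite leNgt; apply/negP => /mini; rewrite ltnn.
apply: le_trans (Uc i); apply: le_measure; rewrite ?inE//; exact: measurableI.
Unshelve. all: by end_near. Qed.

End lebesgue_cover.

Unset Implicit Arguments.

Theorem theorem2 (R : realType) (n : nat) (n_gt0 : (0 < n)%N)
  (mu : {measure set (n.-tuple R) -> \bar R}) (mu_leb : is_lebesgue_Rn mu)
  (S Sadj : set (n.-tuple R) -> n.-tuple R -> \bar R)
  (r s u v : R)
  (* S maps characteristic functions of Borel sets to non-negative Borel functions *)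
  (S_meas : forall E : set (n.-tuple R), measurable E ->
     measurable_fun [set: n.-tuple R] (S E) /\ (forall x, (0 <= S E x)%E))
  (* linearity of S on characteristic functions: finite additivity *)
  (S_empty : forall x, S set0 x = 0%E)
  (S_add : forall E F : set (n.-tuple R), measurable E -> measurable F -> E `&` F = set0 ->
     forall x, S (E `|` F) x = (S E x + S F x)%E)
  (* the adjoint S^* *)
  (Sadj_meas : forall F : set (n.-tuple R), measurable F ->
     measurable_fun [set: n.-tuple R] (Sadj F) /\ (forall x, (0 <= Sadj F x)%E))
  (S_adjoint : forall E F : set (n.-tuple R), measurable E -> measurable F ->
     (\int[mu]_(x in F) S E x = \int[mu]_(x in E) Sadj F x)%E)
  (* exponents *)
  (r_gt1 : 1 < r) (rs : r < s) (u_gt0 : 0 < u)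
  (us : u < s) (uv : u < v) (rv : r < v)
  (* Hypothesis 1 *)
  (H1 : exists (C : R) (L : seq (R * R * R * R)),
     (forall w, w \in L ->
        let: (u1, u2, u3, u4) := w in
        [/\ u1 + u2 = dual_exp r / (dual_exp r - dual_exp s),
            u3 + u4 = r / (s - r) &
            0 < u2 / r - u4 / dual_exp r - 1]) /\
     forall (E1 E2 F : set (n.-tuple R)) (a1 a2 b1 b2 : R),
       measurable E1 -> measurable E2 -> measurable F ->
       (0 < mu E1 < +oo)%E -> (0 < mu E2 < +oo)%E -> (0 < mu F < +oo)%E ->
       0 < a1 -> 0 < a2 -> 0 < b1 -> 0 < b2 ->
       (forall x, F x -> (a1%:E <= S E1 x)%E) ->
       (forall x, F x -> (a2%:E <= S E2 x)%E) ->
       (b1%:E <= pairS mu S E1 F * ((fine (mu E1))^-1)%:E)%E ->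
       (b2%:E <= pairS mu S E2 F * ((fine (mu E2))^-1)%:E)%E ->
       a1 <= a2 -> b2 <= b1 ->
       exists2 w, w \in L &
         let: (u1, u2, u3, u4) := w in
         a1 `^ u1 * a2 `^ u2 * b1 `^ u3 * b2 `^ u4 <= C * fine (mu E2))
  (* Hypothesis 2 *)
  (H2 : exists (C : R) (L : seq (R * R * R * R)),
     (forall w, w \in L ->
        let: (v1, v2, v3, v4) := w in
        [/\ v1 + v2 = dual_exp s / (dual_exp r - dual_exp s),
            v3 + v4 = s / (s - r) &
            0 < v4 / dual_exp s - v2 / s - 1]) /\
     forall (E F1 F2 : set (n.-tuple R)) (a1 a2 b1 b2 : R),
       measurable E -> measurable F1 -> measurable F2 ->
       (0 < mu E < +oo)%E -> (0 < mu F1 < +oo)%E -> (0 < mu F2 < +oo)%E ->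
       0 < a1 -> 0 < a2 -> 0 < b1 -> 0 < b2 ->
       (forall x, E x -> (b1%:E <= Sadj F1 x)%E) ->
       (forall x, E x -> (b2%:E <= Sadj F2 x)%E) ->
       (a1%:E <= pairS mu S E F1 * ((fine (mu F1))^-1)%:E)%E ->
       (a2%:E <= pairS mu S E F2 * ((fine (mu F2))^-1)%:E)%E ->
       a2 <= a1 -> b1 <= b2 ->
       exists2 w, w \in L &
         let: (v1, v2, v3, v4) := w in
         a1 `^ v1 * a2 `^ v2 * b1 `^ v3 * b2 `^ v4 <= C * fine (mu F2)) :
  (* conclusion: S extends to a bounded linear operator L^{r,u} -> L^{s,v} *)
  exists (T : (n.-tuple R -> R) -> (n.-tuple R -> R)) (C : R),
    [/\ (* T extends S *)
        forall E : set (n.-tuple R), measurable E -> (mu E < +oo)%E ->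
          {ae mu, forall x, (T (\1_E) x)%:E = S E x},
        (* T is linear on L^{r,u} *)
        forall (f g : n.-tuple R -> R) (c : R),
          in_lorentz mu r u f -> in_lorentz mu r u g ->
          {ae mu, forall x, T (fun y => c * f y + g y) x = c * T f x + T g x} &
        (* T is bounded from L^{r,u} to L^{s,v} *)
        forall f, in_lorentz mu r u f ->
          in_lorentz mu s v (T f) /\
          (lorentz_norm mu s v (T f) <= C%:E * lorentz_norm mu r u f)%E].
Proof.
have r0 : 0 < r by apply: lt_trans r_gt1.
have s_gt1 : 1 < s by apply: lt_trans rs.
have s0 : 0 < s by apply: lt_trans rs.
have v0 : 0 < v by apply: lt_trans rv.
(* [q] is 1/p, the midpoint of an interval that the conditions on the exponents make nonempty. *)
pose q := (Num.max r u + Num.min s v) / 2.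
have maxmin : Num.max r u < Num.min s v by rewrite gt_max !lt_min rs rv us uv.
have maxq : Num.max r u < q by rewrite /q; lra.
have qmin : q < Num.min s v by rewrite /q; lra.
move: maxq qmin; rewrite gt_max lt_min => /andP[rq uq] /andP[qs qv].
have q0 : 0 < q by apply: lt_trans rq.
have sp : s^-1 < q^-1 by rewrite ltf_pV2.
have pr : q^-1 < r^-1 by rewrite ltf_pV2.
have up : u <= q^-1^-1 by rewrite invrK ltW.
have pv : q^-1^-1 <= v by rewrite invrK ltW.
have ri1 : r^-1 < 1 by rewrite invf_lt1.
have be1 : 1 - s^-1 < 1 by rewrite gtrBl invr_gt0.
have abgt1 : 1 < r^-1 + (1 - s^-1).
  by have : s^-1 < r^-1 := lt_trans sp pr; lra.
have S0 : nonneg_measurable S := S_meas.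
have S'0 : nonneg_measurable Sadj := Sadj_meas.
have SS' : adjoint mu S Sadj := S_adjoint.
have nz : [/\ r != 0, s != 0, r - 1 != 0, s - 1 != 0 & s - r != 0].
  by split; rewrite gt_eqF ?subr_gt0.
have [rn sn r1n s1n srn] := nz.
have gE : r^-1 + (1 - s^-1) - 1 = (s - r) / (r * s) by field; rewrite rn sn.
have gE' : 1 - s^-1 + r^-1 - 1 = (s - r) / (r * s) by field; rewrite rn sn.
have dualB : dual_exp r - dual_exp s = (s - r) / ((r - 1) * (s - 1)).
  by rewrite /dual_exp; field; rewrite r1n s1n.
have dualV t w : t != 0 -> t - 1 != 0 -> w / dual_exp t = w * (1 - t^-1).
  by move=> t0 t1; rewrite /dual_exp; field; rewrite t0 t1.
(* With [al] = 1/r and [be] = 1/s' the excess [al + be - 1] is (s - r) / (r s); the prescribed sums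
   are rewritten through it. *)
have est : two_set_estimate mu S r^-1 (1 - s^-1).
  have [C [L [hL h]]] := H1; exists C, L; split.
    move=> [[[w1 w2] w3] w4] /hL[h12 h34 h24]; split.
    - by rewrite h12 dualB gE /dual_exp; field; rewrite rn sn r1n s1n srn.
    - by rewrite h34 gE; field; rewrite rn sn srn.
    - by move: h24; rewrite dualV//.
  exact: h.
(* In Hypothesis 2 the heights are the beta's and the densities the alpha's, so the two pairs of
   exponents trade places. *)
have est' : two_set_estimate mu Sadj (1 - s^-1) r^-1.
  have [C [L [hL h]]] := H2.
  exists C, [seq (w.1.2, w.2, w.1.1.1, w.1.1.2) | w <- L]; split.
    move=> _ /mapP[[[[w1 w2] w3] w4] /hL[h12 h34 h24] ->]/=; split.
    - by rewrite h34 gE'; field; rewrite rn sn srn.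
    - by rewrite h12 dualB gE' /dual_exp; field; rewrite rn sn r1n s1n srn.
    - by move: h24; rewrite dualV// subKr.
  move=> F1 F2 E b1 b2 a1 a2 mF1 mF2 mE F1b F2b Eb b10 b20 a10 a20 h1 h2 h3 h4 b12 a21.
  have [||w wL hw] := h E F1 F2 a1 a2 b1 b2 mE mF1 mF2 Eb F1b F2b a10 a20 b10 b20 h1 h2 _ _ a21 b12.
  - by rewrite /pairS S_adjoint.
  - by rewrite /pairS S_adjoint.
  exists (w.1.2, w.2, w.1.1.1, w.1.1.2); first by apply/mapP; exists w.
  case: w wL hw => [[[w1 w2] w3] w4] _ /= hw; apply: le_trans hw.
  by rewrite le_eqVlt; apply/orP; left; apply/eqP; ring.
have [U [mU Ue UT]] := small_cover n_gt0 mu_leb (@ltr01 R).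
have Uoo i : (mu (U i) < +oo)%E by apply: le_lt_trans (Ue i) _; rewrite ltry.
have [K K0 hK] := lorentz_norm_bound S0 S'0 SS' r_gt1 s0 u_gt0 sp pr up pv est est'
  (@atomless R n mu n_gt0 mu_leb).
have [K1 K10 hK1] := dual_bound S0 S'0 SS' r_gt1 s0 u_gt0 sp pr up est est'.
have ext f : in_lorentz mu r u f -> extendable mu Sadj f.
  move=> [mf foo]; split => // F mF Foo.
  have Ioo : (lorentz_integral mu r u f < +oo)%E.
    by apply: lty_poweRy foo; rewrite invr_eq0 gt_eqF.
  have Ifin : lorentz_integral mu r u f \is a fin_num.
    by rewrite ge0_fin_numE// lorentz_integral_ge0.
  have Ffin : mu F \is a fin_num by rewrite ge0_fin_numE.
  (* [dual_bound] with a single tested set; the size [fine (mu F) + 1] stays positive even for a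
     null [F]. *)
  pose G k := if k == 0%N then F else set0.
  have mG k : measurable (G k) by rewrite /G; case: ifP.
  have y0 : 0 < fine (mu F) + 1 by rewrite ltr_wpDl// fine_ge0.
  have Gy k : (mu (G k) <= ((fine (mu F) + 1) * 2 ^+ k)%:E)%E.
    rewrite /G; case: eqP => [->|_]; last by rewrite measure0 lee_fin mulr_ge0 ?(ltW y0)// exprn_ge0.
    by rewrite expr0 mulr1 EFinD fineK// leeDl.
  have := hK1 f (fine (lorentz_integral mu r u f)) G _ 1%N (fun=> 1) mf _ _ y0 mG Gy (fun=> ler01).
  rewrite big_ord1 mul1e /= fineK// => /(_ _ _)/le_lt_trans; apply => //.
  - by rewrite fine_ge0// lorentz_integral_ge0.
  - by rewrite ltry.
exists (extension S), K; split.
- move=> E mE Eoo; apply: (extension_indic mU Uoo UT S0 S'0 SS' mE).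
  split=> [|F mF Foo]; first exact: measurable_indic.
  (* For indicators the restricted bound gives the finiteness directly, without a Lorentz norm of
     \1_E. *)
  have [C C0 rb] := restricted_bound_of_estimate S0 S'0 SS' be1 abgt1 est.
  apply: (@le_lt_trans _ _ (\int[mu]_(x in E) Sadj F x)%E).
    rewrite [leRHS]integral_mkcond le_eqVlt; apply/orP; left; apply/eqP.
    apply: eq_integral => x _; rewrite patchE indicE ger0_norm//.
    by case: ifP => _; rewrite ?mul1e ?mul0e.
  rewrite -S_adjoint//; apply: le_lt_trans (restricted_bound_fine S0 S'0 SS' rb (ltW C0) mE mF Eoo Foo) _.
  by rewrite ltry.
- move=> f g c /ext ef /ext eg; exact: (extension_linear mU Uoo UT S0 S'0 SS').
- move=> f hf; have [mf foo] := hf.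
  have mT : measurable_fun [set: n.-tuple R] (extension S f) by exact: measurable_extension.
  have bound : (lorentz_norm mu s v (extension S f) <= K%:E * lorentz_norm mu r u f)%E.
    apply: hK => // F mF Foo.
    exact: (extension_abs_integral mU Uoo UT S0 S'0 SS' (ext f hf) mF).
  split => //; split => //; apply: le_lt_trans bound _.
  by apply: lte_mul_pinfty; rewrite ?lee_fin ?(ltW K0).
Qed.
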